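(* Let $(E,g,\rho)$ be a Courant vector bundle over $M$ with a surjective anchor $\rho:E\to TM$, for which a choice of a splitting $E=P\oplus C$, $P=\mathrm{im}\,\partial\oplus Q$, and of a suitable connection $\nabla$ on $E$ is made (as described in the context). Then $(E,g,\rho)$ has a structure of pre-Courant algebroid with the bracket $[\,,\,]_1$ (defined in the context) given by the formulas $$[q_1+\partial f_1,q_2+\partial f_2]_1=\sigma[\rho q_1,\rho q_2]+\tfrac12\left[\partial((\rho q_1)f_2)-\partial((\rho q_2)f_1)\right],$$ $$[c_1,c_2]_1=-\gamma(c_1,c_2),\qquad [c,q+\partial f]_1=-\nabla_{\rho q}c,$$ where $f,f_1,f_2\in C^\infty(M)$, $q,q_1,q_2\in\Gamma Q$, $c,c_1,c_2\in\Gamma C$. Furthermore, $[\,,\,]_1$ is a Courant algebroid bracket if and only if the connection $\nabla$ is flat.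
   Context: Everything is $C^\infty$; $\Gamma$ denotes global cross sections; brackets are $\mathbb{R}$-bilinear. A pseudo-Euclidean vector bundle $(E\to M,g)$ is a real vector bundle with a symmetric, non-degenerate fiber inner product $g$. For a morphism $\rho:E\to TM$, $\partial:T^*M\to E$ is $\partial=\frac12\sharp_g\circ{}^t\rho$ (${}^t\rho$ the transpose, $\sharp_g:E^*\to E$ the isomorphism induced by $g$) and $\partial f=\partial(df)$, i.e. $g(\partial f,e)=\frac12(\rho e)f$. A Courant vector bundle is $(E,g,\rho)$ with $\mathrm{im}\,\rho$ a (generalized) foliation and $\mathrm{im}\,\partial$ $g$-isotropic (equivalently $\rho\circ\partial=0$). A pre-Courant algebroid is a Courant vector bundle with a skew-symmetric bracket on $\Gamma E$ such that for all $e,e_1,e_2\in\Gamma E$: (i) $\rho[e_1,e_2]=[\rho e_1,\rho e_2]$; (v) $(\rho e)(g(e_1,e_2))=g([e,e_1]+\partial g(e,e_1),e_2)+g(e_1,[e,e_2]+\partial g(e,e_2))$; these imply (ii) $\rho\circ\partial=0$ and (iv) $[e_1,fe_2]=f[e_1,e_2]+((\rho e_1)f)e_2-g(e_1,e_2)\partial f$ for $f\in C^\infty(M)$. It is a (skew-symmetric) Courant algebroid if also (iii) $\sum_{Cycl}[[e_1,e_2],e_3]=\frac13\partial[\sum_{Cycl}g([e_1,e_2],e_3)]$ for all $e_1,e_2,e_3\in\Gamma E$. Splitting. Let $\rho$ be surjective and $K=\ker\rho$; then $K^{\perp_g}=\mathrm{im}\,\partial\subseteq K$. A splitting consists of an isotropic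 subbundle $Q$ complementary to $K$ in $E$ and a subbundle $C$ complementary to $\mathrm{im}\,\partial$ in $K$ such that, with $P=\mathrm{im}\,\partial\oplus Q$, $E=P\oplus C$ is a $g$-orthogonal decomposition, $g|_C$ is non-degenerate, and $g|_P$ is non-degenerate of signature zero. $\sigma:TM\to Q$ is the inverse of the isomorphism $\rho|_Q$, and $p_{\mathrm{im}\,\partial}$ is the projection of $E=\mathrm{im}\,\partial\oplus Q\oplus C$ onto $\mathrm{im}\,\partial$. Suitable connection. A suitable connection is a metric connection $\nabla=\nabla^{\mathrm{im}\,\partial}\oplus\nabla^Q\oplus\nabla^C$ on $E$, where $\nabla^C$ is a metric connection on $(C,g|_C)$, $\nabla^Q$ is an arbitrary connection on $Q$, and $\nabla^{\mathrm{im}\,\partial}$ is defined by $X(g(q,\partial f))=g(q,\nabla^{\mathrm{im}\,\partial}_X(\partial f))+g(\nabla^Q_Xq,\partial f)$ for $q\in\Gamma Q$, $X\in\Gamma TM$, $f\in C^\infty(M)$. Bracket. Let $T_{(\nabla,\rho)}(e_1,e_2)=\rho(\nabla_{\rho e_1}e_2-\nabla_{\rho e_2}e_1)-[\rho e_1,\rho e_2]$, let $\gamma(e_1,e_2)\in\Gamma E$ be defined by $g(\gamma(e_1,e_2),e)=\frac12[g(e_1,\nabla_{\rho e}e_2)-g(e_2,\nabla_{\rho e}e_1)]$ for all $e\in\Gamma E$, let $B_1\in\Gamma\wedge^3E^*$ be $B_1(e_1,e_2,e_3)=\sum_{Cycl(1,2,3)}g(\sigma(T_{(\nabla,\rho)}(e_1,e_2)),p_{\mathrm{im}\,\partial}(e_3))$,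 and let $\beta_1$ be defined by $g(\beta_1(e_1,e_2),e_3)=B_1(e_1,e_2,e_3)$. Then $[e_1,e_2]_1=\nabla_{\rho e_1}e_2-\nabla_{\rho e_2}e_1-\gamma(e_1,e_2)-\beta_1(e_1,e_2)$. Brackets with general sections $\sum_ih_i\partial f_i$ of $\mathrm{im}\,\partial$ are deduced from the formulas of the claim by means of property (iv).
   Formalization: Since the bracket does not depend on the arbitrary connection ∇^Q, the ''only if'' half is false for the whole ∇; it is proved instead that the bracket is Courant if and only if ∇^C is flat, and that flatness of ∇ suffices. *)

(* Defs.v *)
From HB Require Import structures.
From mathcomp Require Import all_boot all_order all_algebra.
From mathcomp Require Import all_classical all_reals all_analysis.
Set Implicit Arguments.
Unset Strict Implicit.
Unset Printing Implicit Defensive.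
Import Order.TTheory GRing.Theory Num.Theory numFieldNormedType.Exports.
Local Open Scope classical_set_scope.
Local Open Scope ring_scope.

(* For U open: f is k times differentiable on U and all its iterated partial
   derivatives of order <= k are continuous on U. *)
Fixpoint Ck (R : realType) (n k : nat) (U : set 'rV[R]_n) (f : 'rV[R]_n -> R^o)
    : Prop :=
  match k with
  | 0 => forall x, U x -> {for x, continuous f}
  | k'.+1 => (forall x, U x -> differentiable f x) /\
             (forall v : 'rV[R]_n, Ck k' U (fun x => 'D_v f x))
  end.

Definition Cinfty (R : realType) (n : nat) (U : set 'rV[R]_n)
  (f : 'rV[R]_n -> R) : Prop := forall k, Ck k U f.

Record chart (R : realType) (M : topologicalType) (n : nat) := Chart {
  cdom : set M;
  cmap : M -> 'rV[R]_n;
  cinv : 'rV[R]_n -> M;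
  cdom_open : open cdom;
  cimg_open : open (cmap @` cdom);
  cmapK : forall x, cdom x -> cinv (cmap x) = x;
  cmap_cont : {within cdom, continuous cmap};
  cinv_cont : {within cmap @` cdom, continuous cinv} }.

Definition smooth_transition (R : realType) (M : topologicalType) (n : nat)
    (c c' : chart R M n) : Prop :=
  forall j : 'I_n,
    Cinfty (cmap c @` (cdom c `&` cdom c')) (fun y => cmap c' (cinv c y) 0 j).

Record manifold (R : realType) := Manifold {
  mpoints :> topologicalType;
  mdim : nat;
  matlas : set (chart R mpoints mdim);
  matlas_cover : forall x, exists2 c, matlas c & cdom c x;
  matlas_compat : forall c c', matlas c -> matlas c' -> smooth_transition c c';
  mhausdorff : hausdorff_space mpoints;
  msecond_countable : @second_countable mpoints }.

Section Functions.
Context {R : realType} {M : manifold R}.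

(* Only meaningful for W open. *)
Definition smooth_on (W : set M) (f : M -> R) : Prop :=
  forall c, matlas c -> Cinfty (cmap c @` (cdom c `&` W)) (f \o cinv c).

Definition smooth (f : M -> R) : Prop := smooth_on setT f.

End Functions.

(* Sections, not necessarily smooth, of a family of vector spaces, with the
   pointwise operations. *)
Definition dfun (R : realType) (I : Type) (F : I -> lmodType R) : Type :=
  forall x, F x.

Section DfunLmodule.
Context {R : realType} {I : Type} {F : I -> lmodType R}.
Implicit Types s t u : dfun F.

HB.instance Definition _ := gen_eqMixin (dfun F).
HB.instance Definition _ := gen_choiceMixin (dfun F).

Definition dfun_zero : dfun F := fun=> 0.
Definition dfun_opp s : dfun F := fun x => - s x.
Definition dfun_add s t : dfun F := fun x => s x + t x.
Definition dfun_scale (a : R) s : dfun F := fun x => a *: s x.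

Fact dfun_addA : associative dfun_add.
Proof. by move=> s t u; apply: functional_extensionality_dep => x; exact: addrA. Qed.
Fact dfun_addC : commutative dfun_add.
Proof. by move=> s t; apply: functional_extensionality_dep => x; exact: addrC. Qed.
Fact dfun_add0 : left_id dfun_zero dfun_add.
Proof. by move=> s; apply: functional_extensionality_dep => x; exact: add0r. Qed.
Fact dfun_addN : left_inverse dfun_zero dfun_opp dfun_add.
Proof. by move=> s; apply: functional_extensionality_dep => x; exact: addNr. Qed.

HB.instance Definition _ := GRing.isZmodule.Build (dfun F)
  dfun_addA dfun_addC dfun_add0 dfun_addN.

Fact dfun_scaleA (a b : R) s :
  dfun_scale a (dfun_scale b s) = dfun_scale (a * b) s.
Proof. by apply: functional_extensionality_dep => x; exact: scalerA. Qed.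
Fact dfun_scale1 : left_id 1 dfun_scale.
Proof. by move=> s; apply: functional_extensionality_dep => x; exact: scale1r. Qed.
Fact dfun_scaleDr : right_distributive dfun_scale +%R.
Proof. by move=> a s t; apply: functional_extensionality_dep => x; exact: scalerDr. Qed.
Fact dfun_scaleDl s : {morph dfun_scale^~ s : a b / a + b}.
Proof. by move=> a b; apply: functional_extensionality_dep => x; exact: scalerDl. Qed.

HB.instance Definition _ := GRing.Zmodule_isLmodule.Build R (dfun F)
  dfun_scaleA dfun_scale1 dfun_scaleDr dfun_scaleDl.

Definition fscale (f : I -> R) s : dfun F := fun x => f x *: s x.

End DfunLmodule.

Section Tangent.
Context {R : realType} {M : manifold R}.

(* Tangent vectors at x are the derivations at x of C^oo(M).  They are encoded
   as functionals on all functions M -> R that vanish on the non-smooth ones, so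
   that two tangent vectors are equal iff they agree on C^oo(M). *)
Record derivation_at (x : M) (v : (M -> R) -> R) : Prop := {
  der_supp : forall f, ~ smooth f -> v f = 0;
  der_linear : forall (a : R) f g, smooth f -> smooth g ->
    v (fun y => a * f y + g y) = a * v f + v g;
  der_leibniz : forall f g, smooth f -> smooth g ->
    v (fun y => f y * g y) = f x * v g + g x * v f }.

Definition tangent_pred (x : M) : {pred ((M -> R) -> R)} :=
  fun v => `[< derivation_at x v >].

Fact tangent_submod_closed x : submod_closed (tangent_pred x).
Proof.
split=> [|a u v /asboolP [us ul ud] /asboolP [vs vl vd]]; apply/asboolP; split.
- by [].
- by move=> a f g _ _; rewrite mulr0 addr0.
- by move=> f g _ _; rewrite !mulr0 addr0.
- move=> f nf; change (a * u f + v f = 0).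
  by rewrite us // vs // mulr0 addr0.
- move=> b f g sf sg; change (a * u (fun y => b * f y + g y) +
    v (fun y => b * f y + g y) = b * (a * u f + v f) + (a * u g + v g)).
  by rewrite ul // vl // !mulrDr !mulrA (mulrC a b) addrACA.
- move=> f g sf sg; change (a * u (fun y => f y * g y) +
    v (fun y => f y * g y) = f x * (a * u g + v g) + g x * (a * u f + v f)).
  by rewrite ud // vd // !mulrDr !mulrA (mulrC a (f x)) (mulrC a (g x)) addrACA.
Qed.

HB.instance Definition _ (x : M) :=
  GRing.isSubmodClosed.Build R ((M -> R) -> R) (tangent_pred x)
    (tangent_submod_closed x).

Record tangent (x : M) := Tangent {
  tvec :> (M -> R) -> R;
  tvecP : tvec \in tangent_pred x }.

HB.instance Definition _ (x : M) := [isSub for @tvec x].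
HB.instance Definition _ (x : M) := [Choice of tangent x by <:].
HB.instance Definition _ (x : M) :=
  [SubChoice_isSubLmodule of tangent x by <:].

Definition vfield : Type := dfun (fun x : M => tangent x : lmodType R).

Definition vapp (X : vfield) (f : M -> R) : M -> R := fun x => X x f.

Definition smooth_vf (X : vfield) : Prop :=
  forall f, smooth f -> smooth (vapp X f).

(* The Lie bracket [X, Y]f = X(Yf) - Y(Xf); the default value 0 of insubd is
   never used when X and Y are smooth. *)
Definition lie (X Y : vfield) : vfield := fun x =>
  insubd (0 : tangent x) (fun f => X x (vapp Y f) - Y x (vapp X f)).

End Tangent.
Arguments vfield {R} M.

HB.instance Definition _ (R : realType) (M : manifold R) :=
  GRing.Lmodule.copy (vfield M) (dfun (fun x : M => tangent x : lmodType R)).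

Record local_triv (R : realType) (M : manifold R) (F : M -> vectType R)
    (r : nat) := LocalTriv {
  tdom : set M;
  tmap : forall x, {linear F x -> 'rV[R]_r};
  tinv : forall x, 'rV[R]_r -> F x;
  tdom_open : open tdom;
  tmapK : forall x, tdom x -> cancel (tmap x) (tinv x);
  tinvK : forall x, tdom x -> cancel (tinv x) (tmap x) }.

Record vbundle (R : realType) (M : manifold R) := VBundle {
  fiber :> M -> vectType R;
  vrank : nat;
  vatlas : set (local_triv fiber vrank);
  vatlas_cover : forall x, exists2 t, vatlas t & tdom t x;
  vatlas_compat : forall t t', vatlas t -> vatlas t' ->
    forall (v : 'rV[R]_vrank) (j : 'I_vrank),
      smooth_on (tdom t `&` tdom t') (fun x => tmap t' x (tinv t x v) 0 j) }.

Definition sect (R : realType) (M : manifold R) (E : vbundle M) : Type :=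
  dfun (fun x : M => E x : lmodType R).

HB.instance Definition _ (R : realType) (M : manifold R) (E : vbundle M) :=
  GRing.Lmodule.copy (sect E) (dfun (fun x : M => E x : lmodType R)).

Definition subfam (R : realType) (M : manifold R) (E : vbundle M) : Type :=
  forall x : M, set (E x).

Section Sections.
Context {R : realType} {M : manifold R} {E : vbundle M}.

Definition smooth_sect_on (W : set M) (s : sect E) : Prop :=
  forall t, vatlas t -> forall j : 'I_(vrank E),
    smooth_on (W `&` tdom t) (fun x => tmap t x (s x) 0 j).

Definition smooth_sect (s : sect E) : Prop := smooth_sect_on setT s.

Definition Gamma (F : subfam E) : set (sect E) :=
  [set s | smooth_sect s /\ forall x, F x (s x)].

Definition whole : subfam E := fun=> setT.

Definition is_subbundle (F : subfam E) : Prop :=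
  exists k : nat, forall x0 : M, exists (W : set M) (b : 'I_k -> sect E),
    [/\ open W, W x0, forall i, smooth_sect_on W (b i) &
     forall x, W x -> free [tuple b i x | i < k] /\
       F x = [set` <<[tuple b i x | i < k]>>%VS]].

(* D X s is only meaningful for X a smooth vector field and s in Gamma F. *)
Record is_connection (F : subfam E)
    (D : vfield M -> sect E -> sect E) : Prop := {
  conn_val : forall X s, smooth_vf X -> Gamma F s -> Gamma F (D X s);
  conn_linl : forall f X Y s, smooth f -> smooth_vf X -> smooth_vf Y ->
    Gamma F s -> D (fscale f X + Y) s = fscale f (D X s) + D Y s;
  conn_linr : forall (a : R) X s t, smooth_vf X -> Gamma F s -> Gamma F t ->
    D X (a *: s + t) = a *: D X s + D X t;
  conn_leibniz : forall f X s, smooth f -> smooth_vf X -> Gamma F s ->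
    D X (fscale f s) = fscale f (D X s) + fscale (vapp X f) s }.

Definition flat (F : subfam E) (D : vfield M -> sect E -> sect E)
    : Prop :=
  forall X Y s, smooth_vf X -> smooth_vf Y -> Gamma F s ->
    D X (D Y s) - D Y (D X s) - D (lie X Y) s = 0.

End Sections.
Arguments whole {R M} E.

(* Meant for subspaces A and B. *)
Definition direct_sum (V : zmodType) (A B S : set V) : Prop :=
  S = [set a + b | a in A & b in B] /\ A `&` B = [set 0].

Record pe_bundle (R : realType) (M : manifold R) := PEBundle {
  pe_bundle_of :> vbundle M;
  metric : forall x : M, pe_bundle_of x -> pe_bundle_of x -> R;
  metric_lin : forall x (a : R) u v w,
    @metric x (a *: u + v) w = a * metric u w + metric v w;
  metric_sym : forall x u v, @metric x u v = metric v u;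
  metric_nondeg : forall x u, (forall v, @metric x u v = 0) -> u = 0;
  metric_smooth : forall (W : set M) (s t : sect pe_bundle_of), open W ->
    smooth_sect_on W s -> smooth_sect_on W t ->
    smooth_on W (fun x => metric (s x) (t x)) }.

Record anchor_map (R : realType) (M : manifold R) (E : vbundle M) := AnchorMap {
  anchor_fun :> forall x : M, {linear E x -> tangent x};
  anchor_smooth : forall (W : set M) (s : sect E) f, open W ->
    smooth_sect_on W s -> smooth f ->
    smooth_on W (fun x => anchor_fun x (s x) f) }.

Section Musical.
Context {R : realType} {M : manifold R} (E : pe_bundle M).

Definition gfun (s t : sect E) : M -> R := fun x => metric (s x) (t x).

(* The inverse of the isomorphism E_x -> E_x^*, u |-> g(u, .). *)
Definition sharp (x : M) (a : E x -> R) : E x :=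
  xget 0 [set u | forall v, metric u v = a v].

(* The section s with g(s, e) = L e for all e in Gamma E. *)
Definition sharp_sect (L : sect E -> M -> R) : sect E :=
  xget 0 [set s | smooth_sect s /\ forall e, smooth_sect e -> gfun s e = L e].

Definition nondegenerate_on (x : M) (A : set (E x)) : Prop :=
  forall u, A u -> (forall v, A v -> metric u v = 0) -> u = 0.

Definition isotropic (x : M) (A : set (E x)) : Prop :=
  forall u v, A u -> A v -> metric u v = 0.

(* The restriction of g to A is non-degenerate with as many positive as negative
   squares. *)
Definition signature_zero (x : M) (A : set (E x)) : Prop :=
  exists V W : {vspace E x},
    [/\ direct_sum [set` V] [set` W] A,
        forall u, u \in V -> u != 0 -> 0 < metric u u,
        forall u, u \in W -> u != 0 -> metric u u < 0,
        forall u v, u \in V -> v \in W -> metric u v = 0 &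
        \dim V = \dim W].

Definition metric_conn (F : subfam E)
    (D : vfield M -> sect E -> sect E) : Prop :=
  forall X s t, smooth_vf X -> Gamma F s -> Gamma F t ->
    vapp X (gfun s t) = gfun (D X s) t \+ gfun s (D X t).

Variable rho : anchor_map E.

Definition anchor_sect (s : sect E) : vfield M := fun x => rho x (s x).

Definition kerA : subfam E := fun x => [set u | rho x u = 0].

(* pcov is (1/2) sharp o ^t rho on cotangent vectors at x, and pd f = pcov (df). *)
Definition pcov (x : M) (a : tangent x -> R) : E x :=
  sharp (fun u => 2^-1 * a (rho x u)).

Definition pd (f : M -> R) : sect E := fun x => pcov (fun v : tangent x => v f).

Definition imD : subfam E :=
  fun x => range (fun a : {linear tangent x -> R^o} => pcov a).

End Musical.
Arguments kerA {R M E} rho x.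
Arguments imD {R M E} rho x.

(* Courant vector bundles with surjective anchor; im rho is then TM, so that it
   is automatically a foliation (with leaves the components of M). *)
Record transitive_cbundle (R : realType) (M : manifold R) := TransitiveCBundle {
  cb_bundle :> pe_bundle M;
  anchor : anchor_map cb_bundle;
  anchor_surj : forall x (v : tangent x), exists u, anchor x u = v;
  imD_isotropic : forall x, isotropic (imD anchor x) }.

Section Courant.
Context {R : realType} {M : manifold R} (E : transitive_cbundle M).
Local Notation rho := (anchor E).
Local Notation dd := (pd rho).
Local Notation rhos := (anchor_sect rho).

Record pre_courant (br : sect E -> sect E -> sect E) : Prop := {
  br_smooth : forall e1 e2, smooth_sect e1 -> smooth_sect e2 ->
    smooth_sect (br e1 e2);
  br_linear : forall (a : R) e1 e1' e2, smooth_sect e1 -> smooth_sect e1' ->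
    smooth_sect e2 -> br (a *: e1 + e1') e2 = a *: br e1 e2 + br e1' e2;
  br_skew : forall e1 e2, smooth_sect e1 -> smooth_sect e2 ->
    br e1 e2 = - br e2 e1;
  br_anchor : forall e1 e2, smooth_sect e1 -> smooth_sect e2 ->
    rhos (br e1 e2) = lie (rhos e1) (rhos e2);
  br_metric : forall e e1 e2,
    smooth_sect e -> smooth_sect e1 -> smooth_sect e2 ->
    vapp (rhos e) (gfun e1 e2) =
      gfun (br e e1 + dd (gfun e e1)) e2 \+ gfun e1 (br e e2 + dd (gfun e e2)) }.

Record courant (br : sect E -> sect E -> sect E) : Prop := {
  courant_pre : pre_courant br;
  courant_jacobi : forall e1 e2 e3,
    smooth_sect e1 -> smooth_sect e2 -> smooth_sect e3 ->
    br (br e1 e2) e3 + br (br e2 e3) e1 + br (br e3 e1) e2 =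
      3^-1 *: dd (fun x => gfun (br e1 e2) e3 x + gfun (br e2 e3) e1 x
                           + gfun (br e3 e1) e2 x) }.

Definition sumP (Q : subfam E) : subfam E := fun x =>
  [set u + q | u in imD rho x & q in Q x].

Arguments sumP Q x : clear implicits.

Unset Implicit Arguments.
Record splitting := Splitting {
  spQ : subfam E;
  spC : subfam E;
  spQ_sub : is_subbundle spQ;
  spC_sub : is_subbundle spC;
  spQ_iso : forall x, isotropic (spQ x);
  spQ_compl : forall x, direct_sum (kerA rho x) (spQ x) setT;
  spC_compl : forall x,
    direct_sum (imD rho x) (spC x) (kerA rho x);
  spPC : forall x, direct_sum (sumP spQ x) (spC x) setT;
  spPC_orth : forall x u c, sumP spQ x u -> spC x c -> metric u c = 0;
  spC_nondeg : forall x, nondegenerate_on (spC x);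
  spP_nondeg : forall x, nondegenerate_on (sumP spQ x);
  spP_sig : forall x, signature_zero (sumP spQ x) }.

Set Implicit Arguments.

Section Split.
Variable S : splitting.
Local Notation Q := (spQ S).
Local Notation C := (spC S).

Definition sigma (X : vfield M) : sect E :=
  fun x => xget 0 [set q | Q x q /\ rho x q = X x].

Definition decomposes (x : M) (e u q c : E x) : Prop :=
  [/\ imD rho x u, Q x q, C x c & e = u + q + c].
Definition prI (s : sect E) : sect E :=
  fun x => xget 0 [set u | exists q c, decomposes (s x) u q c].
Definition prQ (s : sect E) : sect E :=
  fun x => xget 0 [set q | exists u c, decomposes (s x) u q c].
Definition prC (s : sect E) : sect E :=
  fun x => xget 0 [set c | exists u q, decomposes (s x) u q c].

Definition sum_conn (DI DQ DC : vfield M -> sect E -> sect E)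
    (X : vfield M) (s : sect E) : sect E :=
  DI X (prI s) + DQ X (prQ s) + DC X (prC s).

Record suitable_conn := SuitableConn {
  nabI : vfield M -> sect E -> sect E;
  nabQ : vfield M -> sect E -> sect E;
  nabC : vfield M -> sect E -> sect E;
  nabI_conn : is_connection (imD rho) nabI;
  nabQ_conn : is_connection Q nabQ;
  nabC_conn : is_connection C nabC;
  nabC_metric : metric_conn C nabC;
  nabI_def : forall X q f, smooth_vf X -> Gamma Q q -> smooth f ->
    vapp X (gfun q (dd f)) =
      gfun q (nabI X (dd f)) \+ gfun (nabQ X q) (dd f);
  nab_conn : is_connection (whole E) (sum_conn nabI nabQ nabC);
  nab_metric : metric_conn (whole E) (sum_conn nabI nabQ nabC) }.

Definition nabla (N : suitable_conn) : vfield M -> sect E -> sect E :=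
  sum_conn (nabI N) (nabQ N) (nabC N).

Section Bracket.
Variable N : suitable_conn.
Local Notation D := (nabla N).

Definition torsion (e1 e2 : sect E) : vfield M :=
  rhos (D (rhos e1) e2 - D (rhos e2) e1) - lie (rhos e1) (rhos e2).

Definition gamma (e1 e2 : sect E) : sect E :=
  sharp_sect (fun e x =>
    2^-1 * (gfun e1 (D (rhos e) e2) x - gfun e2 (D (rhos e) e1) x)).

Definition B1 (e1 e2 e3 : sect E) : M -> R := fun x =>
  gfun (sigma (torsion e1 e2)) (prI e3) x
  + gfun (sigma (torsion e2 e3)) (prI e1) x
  + gfun (sigma (torsion e3 e1)) (prI e2) x.

Definition beta1 (e1 e2 : sect E) : sect E := sharp_sect (B1 e1 e2).

Definition bracket1 (e1 e2 : sect E) : sect E :=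
  D (rhos e1) e2 - D (rhos e2) e1 - gamma e1 e2 - beta1 e1 e2.

End Bracket.
End Split.
End Courant.
Arguments sumP {R M E} Q x.
Arguments spQ {R M E} s x.
Arguments spC {R M E} s x.

(* Main.v *)
Require Import Defs.
From HB Require Import structures.
From mathcomp Require Import all_boot all_order all_algebra.
From mathcomp Require Import all_classical all_reals all_analysis.
From mathcomp Require Import ring lra.
Set Implicit Arguments.
Unset Strict Implicit.
Unset Printing Implicit Defensive.
Import Order.TTheory GRing.Theory Num.Theory numFieldNormedType.Exports.
Local Open Scope classical_set_scope.
Local Open Scope ring_scope.

(** Below, [rho] is the anchor, [K] its kernel, [T] the torsion and [a o b] the
Dorfman product.

The term [beta1] repairs the anchor: when [beta1 e1 e2] is paired with [pd f],
only [sigma (T e1 e2)] survives, because the torsion vanishes as soon as one of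
its arguments lies in [K].  Hence [rho (beta1 e1 e2) = T e1 e2], which is what
turns the bracket built from the connection into a lift of the Lie bracket
([bracket1_anchor]).  The other axiom holds because the connection is metric
and the trilinear form [B1] is totally skew-symmetric ([bracket1_pre]).  The
closed formulas come from the connection preserving im pd, Q and C, whose
mutual pairings vanish except between im pd and Q and inside C.

For the Jacobi identity, replace the skew bracket by the Dorfman product
[a o b = [a, b] + pd (g a b)].  In every pre-Courant algebroid the Jacobi
expression of the bracket is the opposite of the defect [loday] of the Leibniz
rule [a o (b o c) = (a o b) o c + b o (a o c)] ([jacobi_loday]).  This defect is
C^oo-linear, totally skew-symmetric once paired with a fourth section, and
killed by exact sections, so it only has to be known on sections of Q and C.
With three entries in Q it is the Jacobi identity of vector fields; with three
entries in C it is zero since the product of two sections of C lies in im pd,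
which multiplies to zero with [K]; with two entries in Q and one in C it is the
curvature of the connection on C ([loday_qqc]).  By skew-symmetry these cases
exhaust all others, so that the Jacobi identity is equivalent to the flatness
of the connection on C ([flat_loday], [loday_flat]).

All objects must moreover be smooth.  Bump functions ([cutoff_exists]) make
every C^oo-linear functional on sections pointwise ([tensorial]), so that it is
represented by a smooth section through the metric ([sharp_sectP]).  A section
of a subbundle is smooth as soon as a family of smooth fibrewise linear
functionals separating the points of the fibres takes smooth values on it
([smooth_sect_test]); applied to different families, this gives the smoothness
of sigma, of the projections and of metric duals.  Finally im pd is the
orthogonal of [K], and each of its points is the value of [pd f] for one smooth
function f ([imD_exact]); this is how identities known for exact sections reach
all sections of im pd. *)

(* Both names also belong to the theory of metric spaces. *)
Local Notation metric := Defs.metric.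
Local Notation metric_sym := Defs.metric_sym.

(** * Algebra of functions of class C^k *)

Section SmoothAlgebra.
Context {R : realType} {n : nat}.
Implicit Types (U V : set 'rV[R]_n) (f g : 'rV[R]_n -> R^o).

Lemma Ck_sub k U V f : V `<=` U -> Ck k U f -> Ck k V f.
Proof.
move=> VU; elim: k f => [|k IH] f; first by move=> cf x Vx; exact: cf x (VU _ Vx).
by case=> df Df; split=> [x Vx|v]; [exact: df x (VU _ Vx)|by apply: IH; exact: Df].
Qed.

Lemma Ck_pointwise k U f : (forall x, U x -> Ck k (set1 x) f) -> Ck k U f.
Proof.
elim: k f => [|k IH] f h; first by move=> x Ux; exact: (h x Ux x).
split=> [x Ux|v]; first by case: (h x Ux) => df _; apply: df.
by apply: IH => x Ux; case: (h x Ux) => _; exact.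
Qed.

(** The difference of the two functions vanishes near the point, hence has zero
differential there. *)
Lemma near_eq_differentiable f g x : {near x, f =1 g} ->
  differentiable f x -> differentiable g x.
Proof.
move=> fg df; have -> : g = f \+ (g \- f).
  by apply/funext => y /=; rewrite addrC subrK.
apply: differentiableD => //; set h := (g \- f).
have h0 : h \o shift x = cst (h x) + (0 : 'rV[R]_n -> R^o) +o_ 0 id.
  apply/eqaddoP => _/posnumP[e].
  have nh : \forall y \near x, h y = 0.
    by apply: filterS fg => y; rewrite /h /= => ->; rewrite subrr.
  have hx := nbhs_singleton nh.
  rewrite (near_shift 0 x) in nh; apply: filterS nh => y.
  rewrite /= subr0 => hy.
  rewrite -![(_ + _ : _ -> _) _]/(_ + _) -![(- _ : _ -> _) _]/(- _) /=.
  by rewrite [h (y + x)]hy hx addr0 subrr normr0 mulr_ge0.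
have dh : 'd h x = (0 : 'rV[R]_n -> R^o) :> ('rV[R]_n -> R^o).
  by apply: diff_unique h0 => //; exact: cst_continuous.
apply/diff_locallyP; rewrite dh; split=> //; exact: cst_continuous.
Qed.

Lemma Ck_ext k U f g : open U -> (forall x, U x -> f x = g x) ->
  Ck k U f -> Ck k U g.
Proof.
move=> oU; elim: k f g => [|k IH] f g fg.
  move=> cf x Ux; have nfg : {near x, f =1 g}.
    by apply: filterS (open_nbhs_nbhs (conj oU Ux)) => y /fg.
  rewrite /prop_for /continuous_at -(fg _ Ux); apply: cvg_trans (cf x Ux).
  exact: (@near_eq_cvg _ _ (nbhs x) _ _ _ nfg).
have nfg x : U x -> {near x, f =1 g}.
  by move=> Ux; apply: filterS (open_nbhs_nbhs (conj oU Ux)) => y /fg.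
case=> df Df; split=> [x Ux|v].
  exact: near_eq_differentiable (nfg x Ux) (df x Ux).
apply: (IH _ _ _ (Df v)) => x Ux; apply: near_eq_derive; exact: nfg.
Qed.

Lemma CkW k U f : Ck k.+1 U f -> Ck k U f.
Proof.
elim: k f => [|k IH] f [df Df]; last by split=> // v; apply: IH; exact: Df.
by move=> x Ux; apply: differentiable_continuous; exact: df.
Qed.

Lemma Ck_cst k U (a : R) : Ck k U (fun=> a).
Proof.
elim: k a => [|k IH] a /=; first by move=> x _; exact: cst_continuous.
split=> [x _|v]; first exact: differentiable_cst.
have -> : (fun x : 'rV[R]_n => 'D_v (fun=> a : R^o) x) = fun=> 0.
  by apply/funext => x; exact: derive_cst.
exact: IH.
Qed.

Lemma CkD k U f g : open U -> Ck k U f -> Ck k U g ->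
  Ck k U (fun x => f x + g x).
Proof.
move=> oU; elim: k f g => [|k IH] f g.
  by move=> cf cg x Ux; exact: (cvgD (cf x Ux) (cg x Ux)).
move=> [df Df] [dg Dg]; split=> [x Ux|v].
  by apply: differentiableD; [exact: df|exact: dg].
apply: (Ck_ext oU _ (IH _ _ (Df v) (Dg v))) => x Ux.
by rewrite -deriveD //; apply: diff_derivable; [exact: df|exact: dg].
Qed.

Lemma CkM k U f g : open U -> Ck k U f -> Ck k U g ->
  Ck k U (fun x => f x * g x).
Proof.
move=> oU; elim: k f g => [|k IH] f g.
  by move=> cf cg x Ux; exact: (cvgM (cf x Ux) (cg x Ux)).
move=> sf sg; have sf' := CkW sf; have sg' := CkW sg.
case: sf sg => [df Df] [dg Dg]; split=> [x Ux|v].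
  by apply: differentiableM; [exact: df|exact: dg].
apply: (Ck_ext oU _ (CkD oU (IH _ _ sf' (Dg v)) (IH _ _ sg' (Df v)))) => x Ux.
rewrite (@deriveM R _ f g) //; apply: diff_derivable; [exact: df|exact: dg].
Qed.

Lemma CkV k U f : open U -> (forall x, U x -> f x != 0) -> Ck k U f ->
  Ck k U (fun x => (f x)^-1).
Proof.
move=> oU f0; elim: k f f0 => [|k IH] f f0.
  by move=> cf x Ux; exact: (cvgV (f0 x Ux) (cf x Ux)).
move=> sf; have sf' := CkW sf.
case: sf => [df Df]; split=> [x Ux|v].
  by apply: differentiableV; [exact: df|exact: f0].
have sV := IH _ f0 sf'.
apply: (Ck_ext oU _ (CkM oU (CkM oU (Ck_cst k U (-1)) (CkM oU sV sV)) (Df v))).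
move=> x Ux.
rewrite (@deriveV R _ f) ?f0 //; last by apply: diff_derivable; exact: df.
by rewrite /GRing.scale /= mulN1r -invfM expr2.
Qed.

End SmoothAlgebra.

(** * Functions flat at the origin *)

Section FlatFunction.
Context {R : realType}.
Implicit Types t : R.

(** The powers [t^-k] are carried along because the derivative of a member of
this family is a combination of two other members, so that one induction on the
order proves all of them smooth. *)
Definition flat_exp (k : nat) (t : R) : R :=
  if 0 < t then t^-1 ^+ k * expR (- t^-1) else 0.

Lemma flat_exp_le0 k t : t <= 0 -> flat_exp k t = 0.
Proof. by rewrite /flat_exp leNgt; case: ifP. Qed.

Lemma flat_exp_ge0 k t : 0 <= flat_exp k t.
Proof.
rewrite /flat_exp; case: ifP => // t0.
by rewrite mulr_ge0 ?expR_ge0 // exprn_ge0 // invr_ge0 ltW.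
Qed.

Lemma flat_exp_gt0 k t : 0 < t -> 0 < flat_exp k t.
Proof. by move=> t0;
  rewrite /flat_exp t0 mulr_gt0 ?expR_gt0 // exprn_gt0 ?invr_gt0. Qed.

(** The exponential series bounds [expR (1 / t)] below by its term of degree
[k + 2].
The quadratic bound makes the derivative at the origin vanish. *)
Lemma flat_exp_bound k t : flat_exp k t <= (k.+2)`!%:R * t ^+ 2.
Proof.
rewrite /flat_exp; case: ifP => t0; last by rewrite mulr_ge0 // sqr_ge0.
have u0 : 0 < t^-1 by rewrite invr_gt0.
have := expR_ge1Dxn k.+1 (ltW u0); rewrite expRN => h.
have {}h : t^-1 ^+ k.+2 / (k.+2)`!%:R <= expR t^-1.
  by apply: le_trans h; rewrite lerDr.
rewrite ler_pdivrMr ?expR_gt0 //; rewrite ler_pdivrMr in h; last first.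
  by rewrite ltr0n fact_gt0.
have t2 : t ^+ 2 * t^-1 ^+ k.+2 = t^-1 ^+ k.
  rewrite -[k.+2]addn2 exprD mulrCA -exprMn divff ?gt_eqF //.
  by rewrite expr1n mulr1.
rewrite -t2; have -> : (k.+2)`!%:R * t ^+ 2 * expR t^-1 =
  t ^+ 2 * (expR t^-1 * (k.+2)`!%:R) by ring.
by rewrite ler_wpM2l ?sqr_ge0.
Qed.

Lemma is_derive_flat_exp k t : is_derive t 1 (flat_exp k) (- k%:R * flat_exp
  k.+1 t + flat_exp k.+2 t).
Proof.
have [t0|t0|->] := ltgtP t 0.
- rewrite !flat_exp_le0 ?ltW // mulr0 addr0.
  apply: (@near_eq_is_derive R R R (cst 0)).
    by near=> y; rewrite flat_exp_le0 // ltW //; near: y; exact: lt_nbhsl.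
- have tn0 : t != 0 by rewrite gt_eqF.
  apply: (@near_eq_is_derive R R R (fun y => y^-1 ^+ k * expR (- y^-1))).
    by near=> y; rewrite /flat_exp ifT //; near: y; exact: lt_nbhsr.
  have dV : is_derive t 1 (fun y : R => y^-1) (- t^-1 ^+ 2).
    apply: DeriveDef; first exact: (@derivableV R _ id).
    by rewrite (@deriveV R _ id) // derive_id -exprVn /GRing.scale /= mulr1.
  have dE : is_derive t 1 (fun y => expR (- y^-1)) (t^-1 ^+ 2 * expR (- t^-1)).
    have dNV := is_deriveN dV.
    have d := @is_derive1_comp R expR (fun y => - y^-1) t _ _ (is_derive_expR _) dNV.
    apply: (is_derive_eq d).
    by rewrite opprK mulrC.
  have dX : is_derive t 1 (fun y : R => y^-1 ^+ k) (- k%:R * t^-1 ^+ k.+1).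
    have -> : (fun y : R => y^-1 ^+ k) = (fun y => y^-1) ^+ k by rewrite exprfctE.
    apply: (is_derive_eq (is_deriveX k dV)).
    case: (k) => [|m]; first by rewrite !mul0r oppr0 scale0r mul0r.
    by rewrite /GRing.scale /= mulrN -mulrA -exprD addn2 mulNr.
  apply: (is_derive_eq (is_deriveM dX dE)).
  rewrite /flat_exp t0 /GRing.scale /=; set u := t^-1; set e := expR _.
  by rewrite !exprS; ring.
- rewrite !flat_exp_le0 // mulr0 addr0.
  suff h0 : (fun h : R => h^-1 *: ((flat_exp k \o shift 0) (h *: 1) - flat_exp k 0))
      @ 0^' --> 0.
    by apply: DeriveDef; [exact: cvgP h0|exact: cvg_lim h0].
  apply/cvgr0Pnorm_lt => e e0; near=> h.
  have hn0 : h != 0 by near: h; exact: nbhs_dnbhs_neq.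
  rewrite /= (flat_exp_le0 k (lexx 0)) subr0 addr0 normrZ normfV ltr_pdivrMl
    ?normr_gt0 //.
  rewrite [h *: _]mulr1 ger0_norm ?flat_exp_ge0 //.
  apply: le_lt_trans (flat_exp_bound k h) _.
  rewrite -real_normK ?num_real // expr2 mulrCA ltr_pM2l ?normr_gt0 //.
  have F0 : 0 < (k.+2)`!%:R :> R by rewrite ltr0n fact_gt0.
  rewrite -ltr_pdivlMl //; near: h; apply: dnbhs0_lt.
  by rewrite mulr_gt0 // invr_gt0.
Unshelve. all: by end_near. Qed.

Context {n : nat}.
Lemma Ck_flat_exp m k (U : set 'rV[R]_n) (f : 'rV[R]_n -> R^o) : open U ->
  Ck m U f -> Ck m U (fun x => flat_exp k (f x)).
Proof.
move=> oU; elim: m k f => [|m IH] k f.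
  move=> cf x Ux; apply: continuous_comp (cf x Ux) _.
  have [d _] := is_derive_flat_exp k (f x).
  by apply: differentiable_continuous; apply/derivable1_diffP.
move=> sf; have sf' := CkW sf.
case: sf => [df Df]; split=> [x Ux|v].
  apply: differentiable_comp; first exact: df.
  by have [d _] := is_derive_flat_exp k (f x); apply/derivable1_diffP.
apply: (Ck_ext oU _ (CkM oU (CkD oU (CkM oU (Ck_cst m U (- k%:R)) (IH k.+1 _
  sf')) (IH k.+2 _ sf')) (Df v))).
move=> x Ux; have differential_at := df x Ux.
have dphi := is_derive_flat_exp k (f x).
have pdiff : differentiable (flat_exp k) (f x).
  by case: dphi => d _; apply/derivable1_diffP.
have dc : differentiable (flat_exp k \o f) x by apply: differentiable_comp.
rewrite [RHS](deriveE _ dc) diff_comp // (deriveE _ differential_at) /=.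
rewrite -[X in 'd (flat_exp k) _ X]mulr1 [X in _ = X]linearZ /= -!deriveE //.
by rewrite (@derive_val _ _ _ _ _ _ _ dphi) /GRing.scale /= mulrC.
Qed.

End FlatFunction.

(** * Smooth functions and bump functions on a manifold *)

Section SmoothFunctions.
Context {R : realType} {M : manifold R}.
Implicit Types (U V W : set M) (f g : M -> R) (x : M).

Lemma chart_image_open (c : chart R M (mdim M)) W : open W ->
  open (cmap c @` (cdom c `&` W)).
Proof.
move=> oW; have oI := @cimg_open _ _ _ c.
rewrite openE => _ [x [cx Wx] <-].
have Ix : (cmap c @` cdom c) (cmap c x) by exists x.
have cinvx : {for cmap c x, continuous (cinv c)}.
  have := @cinv_cont _ _ _ c; rewrite continuous_open_subspace // => h.
  by apply: h; rewrite inE.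
have nW : nbhs (cmap c x) (cinv c @^-1` W).
  by apply: cinvx; rewrite cmapK //; apply: open_nbhs_nbhs.
have nI := open_nbhs_nbhs (conj oI Ix).
rewrite /interior; apply: filterS2 nW nI => y Wy [z cz zy].
exists z => //; split=> //.
by move: Wy; rewrite /preimage /= -zy cmapK.
Qed.

Lemma smooth_on_sub V W f : V `<=` W -> smooth_on W f -> smooth_on V f.
Proof.
move=> VW sf c ac k; apply: Ck_sub (sf c ac k).
by apply: image_subset; apply: setIS.
Qed.

(** Smoothness on a set is a condition at each of its points, which is why the
sets [V] need not be open. *)
Lemma smooth_on_local W f :
  (forall x, W x -> exists2 V, V x & smooth_on V f) -> smooth_on W f.
Proof.
move=> h c ac k; apply: Ck_pointwise => _ [x [cx Wx] <-].
have [V Vx sV] := h x Wx; apply: Ck_sub (sV c ac k) => _ ->.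
by exists x.
Qed.

Lemma smooth_on_ext W f g : open W -> (forall x, W x -> f x = g x) ->
  smooth_on W f -> smooth_on W g.
Proof.
move=> oW fg sf c ac k; apply: Ck_ext (sf c ac k).
  exact: chart_image_open.
by move=> _ [x [cx Wx] <-] /=; rewrite cmapK // fg.
Qed.

Lemma smooth_on_cst W (a : R) : smooth_on W (fun=> a).
Proof. by move=> c ac k; exact: Ck_cst. Qed.

Lemma smooth_onD W f g : open W -> smooth_on W f -> smooth_on W g ->
  smooth_on W (fun x => f x + g x).
Proof.
move=> oW sf sg c ac k.
by apply: CkD (sf c ac k) (sg c ac k); exact: chart_image_open.
Qed.

Lemma smooth_onM W f g : open W -> smooth_on W f -> smooth_on W g ->
  smooth_on W (fun x => f x * g x).
Proof.
move=> oW sf sg c ac k.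
by apply: CkM (sf c ac k) (sg c ac k); exact: chart_image_open.
Qed.

Lemma smooth_onN W f : open W -> smooth_on W f ->
  smooth_on W (fun x => - f x).
Proof.
move=> oW sf; apply: (smooth_on_ext oW _ (smooth_onM oW (smooth_on_cst W (-1)) sf)).
by move=> x _; rewrite mulN1r.
Qed.

Lemma smooth_onV W f : open W -> (forall x, W x -> f x != 0) ->
  smooth_on W f -> smooth_on W (fun x => (f x)^-1).
Proof.
move=> oW f0 sf c ac k; apply: CkV (sf c ac k).
  exact: chart_image_open.
by move=> _ [x [cx Wx] <-] /=; rewrite cmapK // f0.
Qed.

Lemma smooth_on_flat_exp W f k : open W -> smooth_on W f ->
  smooth_on W (fun x => flat_exp k (f x)).
Proof.
by move=> oW sf c ac m; apply: Ck_flat_exp (sf c ac m); exact: chart_image_open.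
Qed.

Lemma smooth_on_sum (I : Type) (r : seq I) (P : pred I) W (F : I -> M -> R) :
  open W -> (forall i, smooth_on W (F i)) ->
  smooth_on W (fun x => \sum_(i <- r | P i) F i x).
Proof.
move=> oW sF; elim: r => [|i r IH].
  by apply: (smooth_on_ext oW _ (smooth_on_cst W 0)) => x _; rewrite big_nil.
case Pi: (P i).
  apply: (smooth_on_ext oW _ (smooth_onD oW (sF i) IH)) => x _.
  by rewrite big_cons Pi.
by apply: (smooth_on_ext oW _ IH) => x _; rewrite big_cons Pi.
Qed.

Lemma smooth_on_prod (I : Type) (r : seq I) (P : pred I) W (F : I -> M -> R) :
  open W -> (forall i, smooth_on W (F i)) ->
  smooth_on W (fun x => \prod_(i <- r | P i) F i x).
Proof.
move=> oW sF; elim: r => [|i r IH].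
  by apply: (smooth_on_ext oW _ (smooth_on_cst W 1)) => x _; rewrite big_nil.
case Pi: (P i).
  apply: (smooth_on_ext oW _ (smooth_onM oW (sF i) IH)) => x _.
  by rewrite big_cons Pi.
by apply: (smooth_on_ext oW _ IH) => x _; rewrite big_cons Pi.
Qed.

Lemma smoothW W f : smooth f -> smooth_on W f.
Proof. exact: smooth_on_sub. Qed.

Lemma smooth_cst (a : R) : smooth (fun _ : M => a).
Proof. exact: smooth_on_cst. Qed.

Lemma smoothD f g : smooth f -> smooth g -> smooth (fun x => f x + g x).
Proof. by apply: smooth_onD; exact: openT. Qed.

Lemma smoothM f g : smooth f -> smooth g -> smooth (fun x => f x * g x).
Proof. by apply: smooth_onM; exact: openT. Qed.

Lemma smoothN f : smooth f -> smooth (fun x => - f x).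
Proof. by apply: smooth_onN; exact: openT. Qed.

Lemma smooth_chart_coord (c : chart R M (mdim M)) j : matlas c ->
  smooth_on (cdom c) (fun x => cmap c x 0 j).
Proof. by move=> ac c' ac' k; exact: (matlas_compat ac' ac). Qed.

Lemma chart_cont (c : chart R M (mdim M)) x : cdom c x ->
  {for x, continuous (cmap c : M -> 'rV[R]_(mdim M))}.
Proof.
move=> cx; have := @cmap_cont _ _ _ c.
rewrite continuous_open_subspace; last exact: cdom_open.
by apply; rewrite inE.
Qed.

(** The closed set [K] is what allows to extend by zero, outside [W], the product
of [chi] with an object that is smooth on [W] only. *)
Definition cutoff W x0 (chi : M -> R) : Prop :=
  [/\ smooth chi, nbhs x0 [set x | chi x = 1] &
      exists K, [/\ closed K, K `<=` W & forall x, ~ K x -> chi x = 0]].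

(** A smooth function of [t] going from 1 on [t <= a] to 0 on [b <= t]. *)
Definition smooth_step (a b t : R) : R :=
  flat_exp 0 (b - t) / (flat_exp 0 (b - t) + flat_exp 0 (t - a)).

Lemma smooth_step_den (a b t : R) : a < b ->
  0 < flat_exp 0 (b - t) + flat_exp 0 (t - a).
Proof.
move=> ab; have [tb|bt] := ltP t b.
  by rewrite ltr_pwDl ?flat_exp_ge0 // flat_exp_gt0 // subr_gt0.
by rewrite ltr_wpDl ?flat_exp_ge0 // flat_exp_gt0 // subr_gt0 (lt_le_trans ab).
Qed.

Lemma smooth_step_eq1 (a b t : R) : a < b -> t <= a -> smooth_step a b t = 1.
Proof.
move=> ab ta; have := smooth_step_den t ab;
  rewrite /smooth_step (flat_exp_le0 0 (t := t - a)) ?subr_le0 //.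
by rewrite addr0 => /lt0r_neq0 ?; rewrite divff.
Qed.

Lemma smooth_step_eq0 (a b t : R) : b <= t -> smooth_step a b t = 0.
Proof. by move=> bt; rewrite /smooth_step flat_exp_le0 ?subr_le0 // mul0r. Qed.

Lemma smooth_on_step W f (a b : R) : a < b -> open W -> smooth_on W f ->
  smooth_on W (fun x => smooth_step a b (f x)).
Proof.
move=> ab oW sf.
have s1 : smooth_on W (fun x => flat_exp 0 (b - f x)).
  apply: smooth_on_flat_exp => //; apply: smooth_onD => //; first exact: smooth_on_cst.
  exact: smooth_onN.
have s2 : smooth_on W (fun x => flat_exp 0 (f x - a)).
  by apply: smooth_on_flat_exp => //; apply: smooth_onD => //; exact: smooth_on_cst.
apply: smooth_onM => //; apply: smooth_onV => //; last exact: smooth_onD.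
by move=> x _; rewrite gt_eqF // smooth_step_den.
Qed.

(** In a chart, a product of steps in the squares of the coordinates is supported
in a cube.  The cube is compact, so its inverse image in the manifold is compact,
and closed since the manifold is Hausdorff; this is what makes the extension by
zero smooth. *)
Lemma cutoff_exists W x0 : open W -> W x0 -> exists chi, cutoff W x0 chi.
Proof.
move=> oW Wx0; have [c ac cx0] := matlas_cover x0.
set y0 := cmap c x0; set I := cmap c @` (cdom c `&` W).
have oI : open I by exact: chart_image_open.
have Iy0 : I y0 by exists x0.
have /nbhs_ballP[e /= e0 eI] := open_nbhs_nbhs (conj oI Iy0).
pose d := e / 2; have d0 : 0 < d by rewrite divr_gt0.
have de : d < e by rewrite /d; lra.
have dd : (d / 2) ^+ 2 < d ^+ 2 by rewrite /d; nra.
pose r (x : M) j := (cmap c x 0 j - y0 0 j) ^+ 2.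
pose B : set 'rV[R]_(mdim M) :=
  [set y | forall j, `[y0 0 j - d, y0 0 j + d]%classic (y 0 j)].
have cB : compact B.
  apply: (@rV_compact R _ (fun j => `[y0 0 j - d, y0 0 j + d]%classic)) => j.
  exact: segment_compact.
have BI : B `<=` I.
  move=> y By; apply: eI; split=> // i j; rewrite (ord1 i).
  have := By j; rewrite /= in_itv /= => /andP[h1 h2].
  by rewrite /ball /= ltr_norml; apply/andP; split; lra.
pose K := cinv c @` B.
have KW x : K x -> cdom c x /\ W x.
  by move=> [y /BI [z [cz Wz] <-] <-]; rewrite cmapK.
have cK : closed K.
  apply: compact_closed; first exact: mhausdorff.
  apply: continuous_compact cB; apply: (@continuous_subspaceW _ _ _ (cmap c @` cdom c)).
    by apply: subset_trans BI _; apply: image_subset => x [].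
  exact: cinv_cont.
pose chi x := if pselect (cdom c x) then
  \prod_j smooth_step ((d / 2) ^+ 2) (d ^+ 2) (r x j) else 0.
have chiE x : cdom c x -> chi x = \prod_j smooth_step ((d / 2) ^+ 2) (d ^+ 2) (r x j).
  by rewrite /chi; case: pselect.
have chi0 x : ~ K x -> chi x = 0.
  rewrite /chi; case: pselect => // cx nK.
  have [j nj] : exists j, ~ `[y0 0 j - d, y0 0 j + d]%classic (cmap c x 0 j).
    by apply/existsNP => h; apply: nK; exists (cmap c x); rewrite ?cmapK.
  rewrite (bigD1 j) //= smooth_step_eq0 ?mul0r // /r.
  move/negP: nj; rewrite in_itv /= negb_and -!ltNge.
  by case/orP => h; nra.
exists chi; split; last by exists K; split=> // x /KW[].
- apply: smooth_on_local => x _; have [Kx|nKx] := pselect (K x).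
    exists (cdom c); first by case: (KW x Kx).
    have oc := @cdom_open _ _ _ c.
    apply: (smooth_on_ext oc) (smooth_on_prod _ _ oc _) => [y cy|j].
      by rewrite chiE.
    apply: smooth_on_step => //; apply: smooth_onM => //; apply: smooth_onD => //;
      try exact: smooth_on_cst; exact: smooth_chart_coord.
  exists (~` K) => //.
  apply: (smooth_on_ext _ _ (smooth_on_cst _ 0)); first exact: closed_openC.
  by move=> y /chi0.
- have nc := open_nbhs_nbhs (conj (@cdom_open _ _ _ c) cx0).
  have nb : nbhs x0 (cmap c @^-1` ball y0 (d / 2)).
    by apply: (chart_cont cx0); apply: nbhsx_ballx; rewrite divr_gt0.
  apply: filterS2 nc nb => x cx bx /=; rewrite chiE //.
  apply: big1 => j _; apply: smooth_step_eq1 => //; rewrite /r.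
  have := bx.2 0 j; rewrite /ball /= ltr_norml => /andP[h1 h2]; nra.
Qed.

Lemma cutoff1 W x chi : cutoff W x chi -> chi x = 1.
Proof. by case=> _ /nbhs_singleton. Qed.

Lemma cutoff_smoothM W x0 chi f : open W -> cutoff W x0 chi -> smooth_on W f ->
  smooth (fun x => chi x * f x).
Proof.
move=> oW [schi _ [K [cK KW chi0]]] sf; apply: smooth_on_local => x _.
have [Kx|nKx] := pselect (K x).
  by exists W; [exact: KW|apply: smooth_onM => //; exact: smoothW].
exists (~` K) => //; apply: (smooth_on_ext _ _ (smooth_on_cst _ 0)).
  exact: closed_openC.
by move=> y /chi0 ->; rewrite mul0r.
Qed.

End SmoothFunctions.

(** * Linear systems with smooth coefficients *)

(** The rows are chosen greedily: as long as there are fewer than [k] of them, a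
nonzero column is killed by all, and separation yields a row that does not
kill it. *)
Lemma separating_rows (F : fieldType) (k : nat) (I : Type) (P : I -> 'rV[F]_k) :
  (forall a : 'cV[F]_k, (forall i, P i *m a = 0) -> a = 0) ->
  exists iota : 'I_k -> I, (\matrix_(i < k) P (iota i)) \in unitmx.
Proof.
move=> sep.
suff H m : (m <= k)%N ->
    exists iota : 'I_m -> I, row_free (\matrix_(i < m) P (iota i)).
  have [iota free] := H k (leqnn k).
  by exists iota; rewrite -row_free_unit.
elim: m => [_|m IH mk].
  have iota : 'I_0 -> I by case.
  by exists iota; rewrite /row_free eqn_leq rank_leq_row.
have [iota fA] := IH (ltnW mk); set A := (\matrix_(i < m) _) in fA.
have [v vA v0] : exists2 v : 'rV[F]_k, (v <= kermx A^T)%MS & v != 0.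
  apply/rowV0Pn; rewrite -mxrank_eq0 mxrank_ker mxrank_tr.
  by rewrite (eqP fA) subn_eq0 -ltnNge.
have Av : A *m v^T = 0.
  by apply: trmx_inj; rewrite trmx_mul trmxK trmx0; apply/sub_kermxP.
have [i0 Pi0] : exists i, P i *m v^T != 0.
  apply: contrapT => /forallNP h; move/eqP: v0; apply.
  apply: trmx_inj; rewrite trmx0; apply: sep => i.
  by apply/eqP; apply/negPn/negP; exact: h.
pose iota' (j : 'I_(m + 1)) : I :=
  match fintype.split j with inl j' => iota j' | inr _ => i0 end.
suff free' : row_free (\matrix_(i < m + 1) P (iota' i)).
  by rewrite -addn1; exists iota'.
have -> : \matrix_(i < m + 1) P (iota' i) = col_mx A (P i0).
  apply/matrixP => i j; rewrite !mxE /iota'; case: fintype.split => j'; rewrite ?mxE //.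
  by rewrite (ord1 j').
apply: inj_row_free => w; rewrite -[w]hsubmxK mul_row_col => w0.
have r0 : rsubmx w = 0.
  have := congr1 (fun B => B *m v^T) w0.
  rewrite mulmxDl -mulmxA Av mulmx0 add0r mul0mx -mulmxA.
  move: Pi0; rewrite (mx11_scalar (P i0 *m v^T)) => Pi0.
  rewrite mul_mx_scalar => /eqP; rewrite scaler_eq0 => /orP[/eqP h|/eqP //].
  by move: Pi0; rewrite h raddf0 eqxx.
have l0 : lsubmx w = 0.
  move: w0; rewrite r0 mul0mx addr0 => h.
  by apply: (row_free_inj fA); rewrite h mul0mx.
by rewrite l0 r0 row_mx0.
Qed.

Section SmoothSolve.
Context {R : realType} {M : manifold R}.
Implicit Types (W : set M).

Lemma smooth_on_cont W (f : M -> R) x : open W -> W x -> smooth_on W f ->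
  {for x, continuous f}.
Proof.
move=> oW Wx sf; have [c ac cx] := matlas_cover x.
have c0 : {for cmap c x, continuous (f \o cinv c)}.
  have Ix : (cmap c @` (cdom c `&` W)) (cmap c x) by exists x.
  exact: (sf c ac 0%N _ Ix).
have h : {for x, continuous ((f \o cinv c) \o cmap c)}.
  exact: continuous_comp (chart_cont cx) c0.
have nc : {near x, (f \o cinv c) \o cmap c =1 f}.
  apply: filterS (open_nbhs_nbhs (conj (@cdom_open _ _ _ c) cx)) => y cy /=.
  by rewrite cmapK.
rewrite /prop_for /continuous_at -(nbhs_singleton nc).
by apply: cvg_trans h; exact: (@near_eq_cvg _ _ (nbhs x) _ _ _ nc).
Qed.

Lemma smooth_on_neq0_open W (f : M -> R) : open W -> smooth_on W f ->
  open (W `&` [set x | f x != 0]).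
Proof.
move=> oW sf; rewrite openE => x [Wx fx].
apply: filterI; first exact: open_nbhs_nbhs.
have h : forall A, nbhs (f x) A -> nbhs x (f @^-1` A) := smooth_on_cont oW Wx sf.
apply: (h [set y | y != 0]).
by apply: open_nbhs_nbhs; split => //; exact: open_neq.
Qed.

Lemma smooth_on_det k W (A : M -> 'M[R]_k) : open W ->
  (forall i j, smooth_on W (fun x => A x i j)) ->
  smooth_on W (fun x => \det (A x)).
Proof.
move=> oW sA; apply: smooth_on_sum => // s.
by apply: smooth_onM; [|exact: smooth_on_cst|exact: smooth_on_prod].
Qed.

(** Cramer's rule. *)
Lemma smooth_on_solve k W x0 (A : M -> 'M[R]_k) (a b : M -> 'cV[R]_k) :
  open W -> W x0 -> A x0 \in unitmx ->
  (forall i j, smooth_on W (fun x => A x i j)) ->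
  (forall i, smooth_on W (fun x => b x i 0)) ->
  (forall x, W x -> A x *m a x = b x) ->
  exists V, [/\ open V, V x0, V `<=` W & forall j, smooth_on V (fun x => a x j 0)].
Proof.
move=> oW Wx0 uA sA sb Aab.
have sd := smooth_on_det oW sA.
pose V := W `&` [set x | \det (A x) != 0].
have oV : open V by exact: smooth_on_neq0_open.
exists V; split=> //.
- by split=> //=; move: uA; rewrite unitmxE unitfE.
- by move=> x [].
move=> j.
have VW : V `<=` W by move=> x [].
apply: (@smooth_on_ext _ _ V
  (fun x => (\det (A x))^-1 * \sum_i (\adj (A x)) j i * b x i 0)) => //.
  move=> x [Wx /= dx]; rewrite -(Aab x Wx).
  have -> : \sum_i (\adj (A x)) j i * (A x *m a x) i 0 =
      (\adj (A x) *m (A x *m a x)) j 0 by rewrite mxE.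
  by rewrite mulmxA mul_adj_mx mul_scalar_mx mxE mulKf.
apply: smooth_onM => //.
  apply: smooth_onV => //; last exact: smooth_on_sub sd.
  by move=> x [].
apply: smooth_on_sum => // i; apply: smooth_onM => //; last exact: smooth_on_sub (sb i).
apply: (@smooth_on_ext _ _ V (fun x => cofactor (A x) i j)) => //.
  by move=> x _; rewrite mxE.
apply: smooth_onM => //; first exact: smooth_on_cst.
apply: smooth_on_det => // i' j'.
apply: (@smooth_on_ext _ _ V (fun x => A x (lift i i') (lift j j'))) => //.
  by move=> x _; rewrite !mxE.
exact: smooth_on_sub (sA _ _).
Qed.

End SmoothSolve.

(** * Frames, smooth sections and tensoriality *)

Section Bundles.
Context {R : realType} {M : manifold R} {E : vbundle M}.
Implicit Types (U V W : set M) (s t : sect E) (f : M -> R) (F : subfam E).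

Lemma smooth_sect_on_sub V W s : V `<=` W -> smooth_sect_on W s -> smooth_sect_on V s.
Proof.
move=> VW ss t at_ j; apply: smooth_on_sub (ss t at_ j); exact: setSI.
Qed.

Lemma smooth_sectW W s : smooth_sect s -> smooth_sect_on W s.
Proof. exact: smooth_sect_on_sub. Qed.

Lemma smooth_sect_on_local W s :
  (forall x, W x -> exists2 V, V x & smooth_sect_on V s) -> smooth_sect_on W s.
Proof.
move=> h t at_ j; apply: smooth_on_local => x [Wx tx].
by have [V Vx sV] := h x Wx; exists (V `&` tdom t) => //; exact: sV.
Qed.

Lemma smooth_sect_on_ext W s t : open W -> (forall x, W x -> s x = t x) ->
  smooth_sect_on W s -> smooth_sect_on W t.
Proof.
move=> oW st ss u au j; apply: smooth_on_ext (ss u au j).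
  by apply: openI => //; exact: tdom_open.
by move=> x [Wx _]; rewrite st.
Qed.

Lemma smooth_sect_on0 W : smooth_sect_on W (0 : sect E).
Proof.
move=> t at_ j; have -> : (fun x => tmap t x ((0 : sect E) x) 0 j) = (fun=> 0).
  by apply/funext => x; rewrite (_ : (0 : sect E) x = 0) // linear0 mxE.
exact: smooth_on_cst.
Qed.

Lemma smooth_sect_onD W s t : open W -> smooth_sect_on W s -> smooth_sect_on W t ->
  smooth_sect_on W (s + t).
Proof.
move=> oW ss st u au j; have oWu : open (W `&` tdom u) by apply: openI => //;
  exact: tdom_open.
apply: smooth_on_ext (smooth_onD oWu (ss u au j) (st u au j)) => //.
by move=> x _; rewrite (_ : (s + t) x = s x + t x) // linearD mxE.
Qed.

Lemma smooth_sect_on_fscale W f s : open W -> smooth_on W f -> smooth_sect_on W s ->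
  smooth_sect_on W (fscale f s).
Proof.
move=> oW sf ss u au j; have oWu : open (W `&` tdom u) by apply: openI => //;
  exact: tdom_open.
have sf' : smooth_on (W `&` tdom u) f by apply: smooth_on_sub sf => x [].
apply: smooth_on_ext (smooth_onM oWu sf' (ss u au j)) => //.
by move=> x _; rewrite /fscale linearZ mxE.
Qed.

Lemma smooth_sect_on_sum (I : Type) (r : seq I) W (s : I -> sect E) : open W ->
  (forall i, smooth_sect_on W (s i)) -> smooth_sect_on W (\sum_(i <- r) s i).
Proof.
move=> oW ss; elim: r => [|i r IH]; first by rewrite big_nil; exact: smooth_sect_on0.
by rewrite big_cons; exact: smooth_sect_onD.
Qed.

Lemma smooth_sect0 : smooth_sect (0 : sect E).
Proof. exact: smooth_sect_on0. Qed.

Lemma smooth_sectD s t : smooth_sect s -> smooth_sect t -> smooth_sect (s + t).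
Proof. by apply: smooth_sect_onD; exact: openT. Qed.

Lemma smooth_fscale f s : smooth f -> smooth_sect s -> smooth_sect (fscale f s).
Proof. by apply: smooth_sect_on_fscale; exact: openT. Qed.

Lemma fscale_cst (a : R) s : fscale (fun=> a) s = a *: s.
Proof. by []. Qed.

Lemma smooth_sectZ (a : R) s : smooth_sect s -> smooth_sect (a *: s).
Proof. by rewrite -fscale_cst; apply: smooth_fscale; exact: smooth_cst. Qed.

Lemma smooth_sectN s : smooth_sect s -> smooth_sect (- s).
Proof. by rewrite -scaleN1r; exact: smooth_sectZ. Qed.

Lemma smooth_sectB s t : smooth_sect s -> smooth_sect t -> smooth_sect (s - t).
Proof. by move=> ss st; apply: smooth_sectD => //; exact: smooth_sectN. Qed.

Lemma sect_sumE (I : Type) (r : seq I) (s : I -> sect E) x :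
  (\sum_(i <- r) s i) x = \sum_(i <- r) s i x.
Proof.
elim: r => [|i r IH]; first by rewrite !big_nil.
by rewrite !big_cons -IH.
Qed.

(** Spanning and freeness are expressed by coordinate columns, ready for linear
systems. *)
Definition frame F W k (b : 'I_k -> sect E) : Prop :=
  [/\ open W, forall i, smooth_sect_on W (b i),
      forall x u, W x -> F x u <-> exists c : 'cV[R]_k, u = \sum_i c i 0 *: b i x &
      forall x (c : 'cV[R]_k), W x -> \sum_i c i 0 *: b i x = 0 -> c = 0].

Definition has_frames F : Prop :=
  forall x0, exists W k (b : 'I_k -> sect E), W x0 /\ frame F W b.

Lemma subbundle_frames F : is_subbundle F -> has_frames F.
Proof.
move=> [k hF] x0; have [W [b [oW Wx0 sb hb]]] := hF x0.
have bE x (i : 'I_k) : [tuple b i x | i < k]`_i = b i x.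
  by rewrite -tnth_nth tnth_mktuple.
exists W, k, b; split=> //; split=> // [x u Wx|x c Wx c0].
  have [fr ->] := hb x Wx; split=> [ux|[c ->]].
    exists (\col_i coord [tuple b i x | i < k] i u).
    rewrite [LHS](coord_span ux); apply: eq_bigr => i _.
    by rewrite mxE bE.
  apply: memv_suml => i _; apply: memvZ; apply: memv_span.
  by rewrite -bE; apply: mem_nth; rewrite size_tuple.
have [fr _] := hb x Wx; apply/colP => i; rewrite mxE.
move/freeP: fr => /(_ (fun i => c i 0)); apply.
by rewrite -[RHS]c0; apply: eq_bigr => j _; rewrite bE.
Qed.

Definition triv_frame (t : local_triv E (vrank E)) (i : 'I_(vrank E)) : sect E :=
  fun x => tinv t x (delta_mx 0 i).

Lemma triv_frame_smooth (t : local_triv E (vrank E)) i : vatlas t ->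
  smooth_sect_on (tdom t) (triv_frame t i).
Proof. by move=> at_ t' at' j; exact: vatlas_compat. Qed.

Lemma triv_frameK (t : local_triv E (vrank E)) x (c : 'I_(vrank E) -> R) : tdom t x ->
  tmap t x (\sum_i c i *: triv_frame t i x) = \row_i c i.
Proof.
move=> tx; rewrite linear_sum [RHS]row_sum_delta; apply: eq_bigr => i _.
by rewrite linearZ /= tinvK // mxE.
Qed.

Lemma triv_frameE (t : local_triv E (vrank E)) x (u : E x) : tdom t x ->
  u = \sum_i (tmap t x u) 0 i *: triv_frame t i x.
Proof.
move=> tx; apply: (can_inj (tmapK tx)); rewrite triv_frameK //.
by apply/rowP => i; rewrite mxE.
Qed.

Lemma whole_frames : has_frames (whole E).
Proof.
move=> x0; have [t at_ tx0] := vatlas_cover E x0.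
exists (tdom t), (vrank E), (triv_frame t); split=> //; split.
- exact: tdom_open.
- by move=> i; exact: triv_frame_smooth.
- move=> x u tx; split=> // _; exists (\col_i tmap t x u 0 i).
  by rewrite [LHS](triv_frameE u tx); apply: eq_bigr => i _; rewrite mxE.
- move=> x c tx /(congr1 (tmap t x)); rewrite triv_frameK // linear0 => h.
  by apply/colP => i; move/rowP: h => /(_ i); rewrite !mxE.
Qed.

Lemma frames_lin F : has_frames F -> forall x (a : R) u v,
  F x u -> F x v -> F x (a *: u + v).
Proof.
move=> hF x a u v; have [W [k [b [Wx [_ _ hb _]]]]] := hF x.
move=> /(hb _ _ Wx)[c ->] /(hb _ _ Wx)[d ->]; apply/(hb _ _ Wx).
exists (a *: c + d); rewrite scaler_sumr -big_split /=; apply: eq_bigr => i _.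
by rewrite !mxE scalerDl scalerA.
Qed.

Lemma frames0 F : has_frames F -> forall x, F x 0.
Proof.
move=> hF x; have [W [k [b [Wx [_ _ hb _]]]]] := hF x.
by apply/(hb _ _ Wx); exists 0; rewrite big1 // => i _; rewrite mxE scale0r.
Qed.

Lemma sect_cutoff W x0 chi s : open W -> cutoff W x0 chi -> smooth_sect_on W s ->
  smooth_sect (fscale chi s).
Proof.
move=> oW [schi _ [K [cK KW chi0]]] ss; apply: smooth_sect_on_local => x _.
have [Kx|nKx] := pselect (K x).
  by exists W; [exact: KW|apply: smooth_sect_on_fscale => //; exact: smoothW].
have oK : open (~` K) by exact: closed_openC.
exists (~` K) => //; apply: (smooth_sect_on_ext oK _ (smooth_sect_on0 _)).
by move=> y /chi0; rewrite /fscale => ->; rewrite scale0r.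
Qed.

Lemma Gamma_cutoff F W x0 chi s : has_frames F -> open W -> cutoff W x0 chi ->
  smooth_sect_on W s -> (forall x, W x -> F x (s x)) -> Gamma F (fscale chi s).
Proof.
move=> hF oW hchi ss Fs; split; first exact: sect_cutoff hchi ss.
have [_ _ [K [cK KW chi0]]] := hchi.
move=> x; rewrite /fscale; have [Kx|nKx] := pselect (K x).
  rewrite -[_ *: _]addr0; apply: frames_lin => //; last exact: frames0.
  by apply: Fs; exact: KW.
by rewrite chi0 // scale0r; exact: frames0.
Qed.

Lemma Gamma_extend F x0 (u : E x0) : has_frames F -> F x0 u ->
  exists2 e, Gamma F e & e x0 = u.
Proof.
move=> hF Fu; have [W [k [b [Wx [oW sb hb _]]]]] := hF x0.
have [c uE] := (hb x0 u Wx).1 Fu.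
have [chi hchi] := cutoff_exists oW Wx.
have ss : smooth_sect_on W (\sum_i c i 0 *: b i).
  apply: smooth_sect_on_sum => // i; rewrite -fscale_cst.
  by apply: smooth_sect_on_fscale => //; exact: smooth_on_cst.
exists (fscale chi (\sum_i c i 0 *: b i)).
  apply: Gamma_cutoff hchi ss _ => // x Vx; apply/(hb _ _ Vx).
  by exists c; rewrite sect_sumE.
by rewrite /fscale (cutoff1 hchi) scale1r sect_sumE uE.
Qed.

Lemma sect_extend x0 (u : E x0) : exists2 e : sect E, smooth_sect e & e x0 = u.
Proof.
have [e [se _] eu] := @Gamma_extend (whole E) x0 u whole_frames I.
by exists e.
Qed.

(** Near a point, finitely many of the functionals have an invertible matrix on a
frame of [F]; the coordinates of [s] in the frame then solve a linear system with
smooth coefficients and smooth right-hand side. *)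
Lemma smooth_sect_test F s (I : Type) (l : I -> forall x, E x -> R) :
  has_frames F -> (forall x, F x (s x)) ->
  (forall i x a u v, l i x (a *: u + v) = a * l i x u + l i x v) ->
  (forall i W b, open W -> smooth_sect_on W b -> smooth_on W (fun x => l i x (b x))) ->
  (forall i, smooth (fun x => l i x (s x))) ->
  (forall x u, F x u -> (forall i, l i x u = 0) -> u = 0) ->
  smooth_sect s.
Proof.
move=> hF Fs llin lsm ls lsep.
have l0 i x : l i x 0 = 0.
  have := llin i x 1 0 0; rewrite scale1r addr0 mul1r => /eqP.
  by rewrite -subr_eq0 opprD addNKr oppr_eq0 => /eqP.
have lsum i x k (c : 'cV[R]_k) (b : 'I_k -> E x) :
    l i x (\sum_j c j 0 *: b j) = \sum_j l i x (b j) * c j 0.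
  elim/big_ind2: _ => // [p u q v hp hq|j _].
    by rewrite -[u]scale1r llin mul1r hp hq.
  by rewrite -[c j 0 *: b j]addr0 llin l0 addr0 mulrC.
apply: smooth_sect_on_local => x0 _.
have [W [k [b [Wx0 [oW sb hb hb0]]]]] := hF x0.
have [iota uA] : exists iota : 'I_k -> I,
    (\matrix_(i < k) \row_j l (iota i) x0 (b j x0)) \in unitmx.
  apply: (separating_rows (P := fun i => \row_j l i x0 (b j x0))) => a ha.
  apply: (hb0 x0) => //; apply: lsep => [|i].
    by apply/hb => //; exists a.
  rewrite lsum; have /matrixP/(_ 0 0) := ha i; rewrite !mxE => h.
  by rewrite -[RHS]h; apply: eq_bigr => j _; rewrite mxE.
have hc x : exists c : 'cV[R]_k, W x -> s x = \sum_i c i 0 *: b i x.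
  have [Wx|nWx] := pselect (W x); last by exists 0.
  by have [c h] := (hb x _ Wx).1 (Fs x); exists c.
have [c cE] := choice hc.
pose A x := \matrix_(i < k) \row_j l (iota i) x (b j x).
have [V [oV Vx0 VW sc]] : exists V, [/\ open V, V x0, V `<=` W &
    forall j, smooth_on V (fun x => c x j 0)].
  apply: (@smooth_on_solve _ _ _ W x0 A c (fun x => \col_i l (iota i) x (s x))) => //.
  - move=> i j; apply: (smooth_on_ext oW _ (lsm (iota i) W (b j) oW (sb j))).
    by move=> x _; rewrite !mxE.
  - move=> i; apply: (smooth_on_ext oW _ (smoothW W (ls (iota i)))).
    by move=> x _; rewrite !mxE.
  - move=> x Wx; apply/colP => i; rewrite !mxE cE // lsum.
    by apply: eq_bigr => j _; rewrite !mxE.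
exists V => //; apply: (@smooth_sect_on_ext V (\sum_i fscale (fun x => c x i 0)
  (b i))) => //.
  by move=> x Vx; rewrite sect_sumE cE //; exact: VW.
apply: smooth_sect_on_sum => // i; apply: smooth_sect_on_fscale => //.
exact: smooth_sect_on_sub (sb i).
Qed.

(** C^oo(M)-linearity; additivity is the case [f = 1]. *)
Definition Clinear (L : sect E -> M -> R) : Prop :=
  forall f e e', smooth f -> smooth_sect e -> smooth_sect e' ->
    forall x, L (fscale f e + e') x = f x * L e x + L e' x.

Lemma Clinear0 L x : Clinear L -> L 0 x = 0.
Proof.
move=> hL; have := hL (fun=> 1) 0 0 (smooth_cst 1) smooth_sect0 smooth_sect0 x.
rewrite fscale_cst scaler0 addr0 mul1r => /eqP.
by rewrite -subr_eq0 opprD addNKr oppr_eq0 => /eqP.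
Qed.

Lemma ClinearM L f e x : Clinear L -> smooth f -> smooth_sect e ->
  L (fscale f e) x = f x * L e x.
Proof.
move=> hL sf se; rewrite -[fscale f e]addr0 hL //; last exact: smooth_sect0.
by rewrite Clinear0 // addr0.
Qed.

Lemma ClinearD L e e' x : Clinear L -> smooth_sect e -> smooth_sect e' ->
  L (e + e') x = L e x + L e' x.
Proof.
move=> hL se se'; have := hL (fun=> 1) e e' (smooth_cst 1) se se' x.
by rewrite fscale_cst scale1r mul1r.
Qed.

Lemma ClinearN L e x : Clinear L -> smooth_sect e -> L (- e) x = - L e x.
Proof.
move=> hL se; rewrite -scaleN1r -fscale_cst ClinearM ?mulN1r //.
exact: smooth_cst.
Qed.

Lemma Clinear_sum L k (s : 'I_k -> sect E) x : Clinear L ->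
  (forall i, smooth_sect (s i)) -> L (\sum_i s i) x = \sum_i L (s i) x.
Proof.
move=> hL ss.
suff [_ ->] : smooth_sect (\sum_i s i) /\ L (\sum_i s i) x = \sum_i L (s i) x by [].
elim/big_ind2: _ => //; first by split; [exact: smooth_sect0|exact: Clinear0].
move=> p u q v [su up] [sv vq]; split; first exact: smooth_sectD.
by rewrite ClinearD // up vq.
Qed.

(** Near [x0] the section is a combination of a local frame, with coefficients
vanishing at [x0].  Multiplying by [chi ^ 2] makes the coefficients and the frame
global, one factor [chi] going to each. *)
Lemma tensorial L e x0 : Clinear L -> smooth_sect e -> e x0 = 0 -> L e x0 = 0.
Proof.
move=> hL se e0; have [t at_ tx0] := vatlas_cover E x0.
have ot := @tdom_open _ _ _ _ t.
have [chi hchi] := cutoff_exists ot tx0; have [schi _ [K [cK KW chi0]]] := hchi.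
pose c i x := tmap t x (e x) 0 i.
have sc i : smooth (fun x => chi x * c i x).
  apply: (cutoff_smoothM ot hchi); apply: smooth_on_sub (se t at_ i) => x tx;
    split=> //.
have sb i : smooth_sect (fscale chi (triv_frame t i)).
  by apply: (sect_cutoff ot hchi); exact: triv_frame_smooth.
have sr : smooth (fun x => 1 - chi x * chi x).
  by apply: smoothD; [exact: smooth_cst|apply: smoothN; exact: smoothM].
have eE : e = fscale (fun x => 1 - chi x * chi x) e +
    \sum_i fscale (fun x => chi x * c i x) (fscale chi (triv_frame t i)).
  apply: functional_extensionality_dep => x.
  rewrite [RHS](_ : _ = (1 - chi x * chi x) *: e x + (\sum_i
    fscale (fun x => chi x * c i x) (fscale chi (triv_frame t i))) x) //.
  rewrite sect_sumE /fscale.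
  have [Kx|nKx] := pselect (K x); last first.
    rewrite chi0 // mul0r subr0 scale1r big1 ?addr0 // => i _.
    by rewrite mul0r scale0r.
  rewrite [X in _ = _ + X](_ : _ = (chi x * chi x) *: e x).
    by rewrite -scalerDl subrK scale1r.
  rewrite [X in _ = _ *: X](triv_frameE (e x) (KW x Kx)) scaler_sumr.
  by apply: eq_bigr => i _; rewrite !scalerA /c; congr (_ *: _); ring.
rewrite {1}eE hL //; last by apply: smooth_sect_on_sum => [|i];
  [exact: openT|apply: smooth_fscale; [exact: sc|exact: sb]].
rewrite (cutoff1 hchi) mulr1 subrr mul0r add0r Clinear_sum //; last first.
  by move=> i; apply: smooth_fscale; [exact: sc|exact: sb].
rewrite big1 // => i _; rewrite ClinearM //.
by rewrite /c e0 linear0 mxE mulr0 mul0r.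
Qed.

Lemma tensorial_eq L e e' x0 : Clinear L -> smooth_sect e -> smooth_sect e' ->
  e x0 = e' x0 -> L e x0 = L e' x0.
Proof.
move=> hL se se' ee; apply/eqP; rewrite -subr_eq0 -ClinearN // -ClinearD //.
  apply/eqP; apply: tensorial => //; first exact: smooth_sectB.
  by rewrite [LHS](_ : _ = e x0 - e' x0) // ee subrr.
exact: smooth_sectN.
Qed.

End Bundles.

(** * Duality through the metric *)

Section Metric.
Context {R : realType} {M : manifold R} {E : pe_bundle M}.
Implicit Types (s t e : sect E) (x : M).

Lemma metricDl x (u v w : E x) : metric (u + v) w = metric u w + metric v w.
Proof. by rewrite -{1}[u]scale1r metric_lin mul1r. Qed.

Lemma metric0l x (w : E x) : metric 0 w = 0.
Proof.
have := metricDl 0 0 w; rewrite addr0 => /eqP.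
by rewrite -subr_eq0 opprD addNKr oppr_eq0 => /eqP.
Qed.

Lemma metricZl x a (u w : E x) : metric (a *: u) w = a * metric u w.
Proof. by rewrite -[a *: u]addr0 metric_lin metric0l addr0. Qed.

Lemma metricNl x (u w : E x) : metric (- u) w = - metric u w.
Proof. by rewrite -scaleN1r metricZl mulN1r. Qed.

Lemma metricDr x (u v w : E x) : metric w (u + v) = metric w u + metric w v.
Proof. by rewrite !(metric_sym w) metricDl. Qed.

Lemma metric0r x (w : E x) : metric w 0 = 0.
Proof. by rewrite metric_sym metric0l. Qed.

Lemma metricZr x a (u w : E x) : metric w (a *: u) = a * metric w u.
Proof. by rewrite !(metric_sym w) metricZl. Qed.

Lemma metricNr x (u w : E x) : metric w (- u) = - metric w u.
Proof. by rewrite !(metric_sym w) metricNl. Qed.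

Lemma metric_inj x (u v : E x) : (forall w, metric u w = metric v w) -> u = v.
Proof.
move=> h; apply/eqP; rewrite -subr_eq0; apply/eqP; apply: metric_nondeg => w.
by rewrite metricDl metricNl h subrr.
Qed.

Lemma sect_inj s t : (forall e x, smooth_sect e -> gfun s e x = gfun t e x) -> s = t.
Proof.
move=> h; apply: functional_extensionality_dep => x; apply: metric_inj => w.
have [e se ew] := sect_extend w; have := h e x se.
by rewrite /gfun ew.
Qed.

(** The Gram matrix of a basis is invertible, and its inverse gives the
coordinates of the representing vector. *)
Lemma metric_riesz x (a : E x -> R) : (forall c u v, a (c *: u + v) = c * a u + a v) ->
  exists u, forall v, metric u v = a v.
Proof.
move=> alin.
have a0 : a 0 = 0.
  have := alin 1 0 0; rewrite scale1r addr0 mul1r => /eqP.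
  by rewrite -subr_eq0 opprD addNKr oppr_eq0 => /eqP.
pose X := vbasis (fullv : {vspace E x}); set n := \dim _ in X.
pose G : 'M[R]_n := \matrix_(i, j) metric X`_i X`_j.
have spanE (v : E x) : v = \sum_i coord X i v *: X`_i.
  apply: coord_span; rewrite (span_basis (vbasisP _)); exact: memvf.
have msum (c : 'I_n -> R) v :
  metric (\sum_i c i *: X`_i) v = \sum_i c i * metric X`_i v.
  elim/big_ind2: _ => // [|p u q w <- <-|i _]; first exact: metric0l.
    exact: metricDl.
  exact: metricZl.
have asum (c : 'I_n -> R) : a (\sum_i c i *: X`_i) = \sum_i c i * a X`_i.
  elim/big_ind2: _ => // [p u q w <- <-|i _];
    first by rewrite -{1}[u]scale1r alin mul1r.
  by rewrite -[_ *: _]addr0 alin a0 addr0.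
have uG : G \in unitmx.
  rewrite -row_free_unit; apply: inj_row_free => w wG.
  have : \sum_i w 0 i *: X`_i = 0.
    apply: metric_nondeg => v; rewrite (spanE v) metric_sym msum big1 // => j _.
    rewrite metric_sym msum.
    have /rowP/(_ j) := wG; rewrite !mxE => h.
    suff -> : \sum_i w 0 i * metric X`_i X`_j = 0 by rewrite mulr0.
    by rewrite -[RHS]h; apply: eq_bigr => i _; rewrite mxE.
  have /freeP fr := basis_free (vbasisP (fullv : {vspace E x})).
  by move=> /(fr (fun i => w 0 i)) h; apply/rowP => i; rewrite h mxE.
pose c : 'rV[R]_n := (\row_j a X`_j) *m invmx G.
have cG : c *m G = \row_j a X`_j by rewrite mulmxKV.
exists (\sum_i c 0 i *: X`_i) => v.
rewrite [in RHS](spanE v) asum [X in metric _ X](spanE v) metric_sym msum.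
apply: eq_bigr => j _; congr (_ * _); rewrite metric_sym msum.
have /rowP/(_ j) := cG; rewrite mxE [RHS]mxE => <-.
by apply: eq_bigr => i _; rewrite [G _ _]mxE.
Qed.

Lemma sharpP x (a : E x -> R) : (forall c u v, a (c *: u + v) = c * a u + a v) ->
  forall v, metric (sharp a) v = a v.
Proof.
move=> alin; have [u hu] := metric_riesz alin.
exact: (@xgetPex _ 0 [set u | forall v, metric u v = a v] (ex_intro _ u hu)).
Qed.

Lemma smooth_gfun s t : smooth_sect s -> smooth_sect t -> smooth (gfun s t).
Proof. by move=> ss st; apply: metric_smooth => //; exact: openT. Qed.

Lemma smooth_sect_metric s : (forall e, smooth_sect e -> smooth (gfun e s)) ->
  smooth_sect s.
Proof.
move=> h; apply: (@smooth_sect_test _ _ _ (whole E) s {e : sect E | smooth_sect e}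
  (fun i x u => metric (sval i x) u)) => //.
- exact: whole_frames.
- by move=> e x a u v; rewrite metricDr metricZr.
- by move=> [e se] W b oW sb; apply: metric_smooth => //; exact: smooth_sectW.
- by move=> [e se]; exact: h.
- move=> x u _ hu; apply: metric_nondeg => v; have [e se ev] := sect_extend v.
  by rewrite metric_sym -ev; exact: (hu (exist _ e se)).
Qed.

(** By tensoriality [L] induces a linear form on each fibre, which the metric
represents by a vector; the section so obtained is smooth because its pairings
with smooth sections are the functions [L e]. *)
Lemma sharp_sect_exists (L : sect E -> M -> R) : Clinear L ->
  (forall e, smooth_sect e -> smooth (L e)) ->
  exists s, smooth_sect s /\ forall e, smooth_sect e -> gfun s e = L e.
Proof.
move=> hL sL.
have hext (p : {x : M & E x}) : exists e, smooth_sect e /\ e (projT1 p) = projT2 p.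
  by have [e se eu] := sect_extend (projT2 p); exists e.
have [ext extP] := choice hext.
pose a x (v : E x) := L (ext (existT _ x v)) x.
have aE e x : smooth_sect e -> L e x = a x (e x).
  move=> se; have [sx ex] := extP (existT _ x (e x)).
  by apply: tensorial_eq => //; rewrite ex.
have alin x c u v : a x (c *: u + v) = c * a x u + a x v.
  have [su eu] := extP (existT _ x u); have [sv ev] := extP (existT _ x v).
  have sc := smooth_cst c.
  rewrite /a -(hL (fun=> c)) // -/(a _ _) [RHS]aE; last first.
    by apply: smooth_sectD => //; exact: smooth_fscale.
  by congr a; rewrite [RHS](_ : _ = c *:
    ext (existT _ x u) x + ext (existT _ x v) x) // eu ev.
have hs e : smooth_sect e -> gfun (fun x => sharp (a x)) e = L e.
  move=> se; apply/funext => x; rewrite /gfun sharpP // -aE //.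
exists (fun x => sharp (a x)); split=> //.
apply: smooth_sect_metric => e se.
have -> : gfun e (fun x => sharp (a x)) = L e.
  by rewrite -hs //; apply/funext => x; rewrite /gfun metric_sym.
exact: sL.
Qed.

Lemma sharp_sectP (L : sect E -> M -> R) : Clinear L ->
  (forall e, smooth_sect e -> smooth (L e)) ->
  smooth_sect (sharp_sect L) /\ forall e, smooth_sect e -> gfun (sharp_sect L) e = L e.
Proof.
move=> hL sL; have [s hs] := sharp_sect_exists hL sL.
exact: (@xgetPex _ 0 [set s | smooth_sect s /\ forall e, smooth_sect e ->
  gfun s e = L e]
  (ex_intro _ s hs)).
Qed.

End Metric.

(** * Tangent vectors and the Lie bracket *)

Section VectorFields.
Context {R : realType} {M : manifold R}.
Implicit Types (f g h : M -> R) (X Y Z : vfield M) (x : M).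

Lemma tangentP x (v : tangent x) : derivation_at x v.
Proof. exact/asboolP/(tvecP v). Qed.

Lemma tangent_ext x (v w : tangent x) : (forall f, smooth f -> v f = w f) -> v = w.
Proof.
move=> h; apply: val_inj; apply: funext => f; have [sf|nf] := pselect (smooth f).
  exact: h.
by rewrite /= !(der_supp (tangentP _)).
Qed.

Lemma tangentDE x (v w : tangent x) f : (v + w) f = v f + w f. Proof. by []. Qed.
Lemma tangentZE x a (v : tangent x) f : (a *: v) f = a * v f. Proof. by []. Qed.
Lemma tangent0E x f : (0 : tangent x) f = 0. Proof. by []. Qed.

Lemma tangentD x (v : tangent x) f g : smooth f -> smooth g ->
  v (fun y => f y + g y) = v f + v g.
Proof.
move=> sf sg; rewrite -[v f]mul1r -(der_linear (tangentP v)) //; congr (tvec v _).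
by apply/funext => y; rewrite mul1r.
Qed.

Lemma tangent_zero x (v : tangent x) : v (fun=> 0) = 0.
Proof.
have s0 := @smooth_cst _ M 0; have := tangentD v s0 s0; rewrite addr0 => /eqP.
by rewrite -subr_eq0 opprD addNKr oppr_eq0 => /eqP.
Qed.

Lemma tangentZ x (v : tangent x) a f : smooth f -> v (fun y => a * f y) = a * v f.
Proof.
move=> sf; have s0 := @smooth_cst _ M 0.
rewrite -[RHS]addr0 -[X in _ + X](tangent_zero v) -(der_linear (tangentP v)) //.
by congr (tvec v _); apply/funext => y; rewrite addr0.
Qed.

Lemma tangentN x (v : tangent x) f : smooth f -> v (fun y => - f y) = - v f.
Proof.
move=> sf; rewrite -mulN1r -tangentZ //; congr (tvec v _).
by apply/funext => y; rewrite mulN1r.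
Qed.

Lemma tangentB x (v : tangent x) f g : smooth f -> smooth g ->
  v (fun y => f y - g y) = v f - v g.
Proof. by move=> sf sg; rewrite tangentD ?tangentN //; exact: smoothN. Qed.

Lemma tangentM x (v : tangent x) f g : smooth f -> smooth g ->
  v (fun y => f y * g y) = f x * v g + g x * v f.
Proof. exact: (der_leibniz (tangentP v)). Qed.

Lemma tangent_cst x (v : tangent x) (k : R) : v (fun=> k) = 0.
Proof.
have s1 := @smooth_cst _ M 1; have sk := @smooth_cst _ M k.
have e1 : (fun _ : M => k) = fun y => k * 1 by apply/funext => y; rewrite mulr1.
have := tangentM v sk s1; have := tangentZ v k s1; rewrite -e1; lra.
Qed.

Lemma tangent_sum x (v : tangent x) k (F : 'I_k -> M -> R) : (forall i, smooth (F i)) ->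
  v (fun y => \sum_i F i y) = \sum_i v (F i).
Proof.
move=> sF; elim: k F sF => [|k IH] F sF.
  rewrite [RHS]big_ord0 -[RHS](tangent_zero v); congr (tvec v _); apply/funext => y.
  by rewrite big_ord0.
have sL i : smooth (F (lift ord0 i)) by exact: sF.
have sS : smooth (fun y => \sum_(i < k) F (lift ord0 i) y).
  by apply: smooth_on_sum; [exact: openT|exact: sL].
rewrite big_ord_recl -(IH _ sL) -tangentD //.
by congr (tvec v _); apply/funext => y; rewrite big_ord_recl.
Qed.

Lemma vf_ext X Y : (forall f x, smooth f -> vapp X f x = vapp Y f x) -> X = Y.
Proof.
move=> h; apply: functional_extensionality_dep => x; apply: tangent_ext => f sf.
exact: h.
Qed.

Lemma vappDE X Y f x : vapp (X + Y) f x = vapp X f x + vapp Y f x. Proof. by []. Qed.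
Lemma vappNE X f x : vapp (- X) f x = - vapp X f x. Proof. by []. Qed.
Lemma vappFE h X f x : vapp (fscale h X) f x = h x * vapp X f x. Proof. by []. Qed.
Lemma vapp0E f x : vapp (0 : vfield M) f x = 0. Proof. by []. Qed.

Lemma vappD X f g x : smooth f -> smooth g ->
  vapp X (fun y => f y + g y) x = vapp X f x + vapp X g x.
Proof. exact: tangentD. Qed.
Lemma vappB X f g x : smooth f -> smooth g ->
  vapp X (fun y => f y - g y) x = vapp X f x - vapp X g x.
Proof. exact: tangentB. Qed.
Lemma vappM X f g x : smooth f -> smooth g ->
  vapp X (fun y => f y * g y) x = f x * vapp X g x + g x * vapp X f x.
Proof. exact: tangentM. Qed.
Lemma vappZ X a f x : smooth f -> vapp X (fun y => a * f y) x = a * vapp X f x.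
Proof. exact: tangentZ. Qed.

Lemma smooth_vfD X Y : smooth_vf X -> smooth_vf Y -> smooth_vf (X + Y).
Proof. by move=> sX sY f sf; apply: smoothD; [exact: sX|exact: sY]. Qed.
Lemma smooth_vf_fscale h X : smooth h -> smooth_vf X -> smooth_vf (fscale h X).
Proof. by move=> sh sX f sf; apply: smoothM => //; exact: sX. Qed.
Lemma smooth_vfN X : smooth_vf X -> smooth_vf (- X).
Proof. by move=> sX f sf; apply: smoothN; exact: sX. Qed.
Lemma smooth_vf0 : smooth_vf (0 : vfield M).
Proof. by move=> f _; exact: smooth_cst. Qed.

Lemma lieE X Y f x : smooth_vf X -> smooth_vf Y ->
  vapp (lie X Y) f x = vapp X (vapp Y f) x - vapp Y (vapp X f) x.
Proof.
move=> sX sY; rewrite {1}/vapp /lie.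
set d := (fun f0 : M -> R => _).
suff hd : d \in tangent_pred x.
  by have := insubdK (0 : tangent x) hd; move/(congr1 (fun F => F f)).
apply/asboolP; split.
- move=> g ng; rewrite /d.
  have n0 Z : vapp Z g = fun=> 0.
    by apply/funext => y; exact: (der_supp (tangentP (Z y)) ng).
  by rewrite !n0 !tangent_zero subrr.
- move=> a g h sg sh; rewrite /d.
  have e Z : vapp Z (fun y => a * g y + h y) = fun y => a * vapp Z g y + vapp Z h y.
    by apply/funext => y; exact: (der_linear (tangentP (Z y))).
  rewrite !e !(der_linear (tangentP _)) //; first ring;
    by [exact: sX|exact: sY].
- move=> g h sg sh; rewrite /d.
  have e Z : vapp Z (fun y => g y * h y) = fun y => g y * vapp Z h y + h y * vapp Z g y.
    by apply/funext => y; exact: tangentM.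
  rewrite !e !tangentD ?tangentM //; try (apply: smoothM => //); try exact: sX;
    try exact: sY.
  rewrite /vapp; ring.
Qed.

Lemma smooth_lie X Y : smooth_vf X -> smooth_vf Y -> smooth_vf (lie X Y).
Proof.
move=> sX sY f sf.
have -> : vapp (lie X Y) f = fun x => vapp X (vapp Y f) x - vapp Y (vapp X f) x.
  by apply/funext => x; exact: lieE.
by apply: smoothD; [exact/sX/sY|apply: smoothN; exact/sY/sX].
Qed.

Lemma lie_skew X Y : smooth_vf X -> smooth_vf Y -> lie X Y = - lie Y X.
Proof.
by move=> sX sY; apply: vf_ext => f x sf; rewrite vappNE !lieE // opprB.
Qed.

Lemma lie0r X : smooth_vf X -> lie X 0 = 0.
Proof.
move=> sX; apply: vf_ext => f x sf; rewrite lieE //; last exact: smooth_vf0.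
by rewrite (_ : vapp 0 f = fun=> 0) // /vapp tangent_zero tangent0E subr0.
Qed.

Lemma lie_leibniz X h Y Z : smooth_vf X -> smooth_vf Y -> smooth_vf Z -> smooth h ->
  lie X (fscale h Y + Z) = fscale h (lie X Y) + fscale (vapp X h) Y + lie X Z.
Proof.
move=> sX sY sZ sh; apply: vf_ext => f x sf.
have sYf := sY f sf; have sZf := sZ f sf; have sXf := sX f sf.
have shY := smooth_vf_fscale sh sY.
rewrite !vappDE !vappFE !lieE //; last exact: smooth_vfD.
rewrite (_ : vapp (fscale h Y + Z) f = fun y => h y * vapp Y f y + vapp Z f y) //.
rewrite vappD //; last exact: smoothM.
rewrite vappM // vappDE vappFE; ring.
Qed.

Lemma lie_jacobi X Y Z : smooth_vf X -> smooth_vf Y -> smooth_vf Z ->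
  lie X (lie Y Z) = lie (lie X Y) Z + lie Y (lie X Z).
Proof.
move=> sX sY sZ; apply: vf_ext => f x sf.
have sXY := smooth_lie sX sY; have sYZ := smooth_lie sY sZ; have sXZ :=
  smooth_lie sX sZ.
rewrite vappDE !lieE //.
have e A B g : smooth_vf A -> smooth_vf B ->
    vapp (lie A B) g = fun y => vapp A (vapp B g) y - vapp B (vapp A g) y.
  by move=> sA sB; apply/funext => y; exact: lieE.
rewrite !e // !vappB ?lieE //; do ?[apply: sX|apply: sY|apply: sZ] => //; ring.
Qed.

End VectorFields.

(** * The map pd and its image *)

Section CourantBundle.
Context {R : realType} {M : manifold R} {E : transitive_cbundle M}.
Local Notation rho := (anchor E).
Local Notation dd := (pd rho).
Local Notation rhos := (anchor_sect rho).
Implicit Types (s t e : sect E) (f h : M -> R) (x : M).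

Lemma smooth_rhos s : smooth_sect s -> smooth_vf (rhos s).
Proof. by move=> ss f sf; apply: anchor_smooth => //; exact: openT. Qed.

Lemma rhosD s t : rhos (s + t) = rhos s + rhos t.
Proof. by apply: functional_extensionality_dep => x; exact: linearD. Qed.
Lemma rhosN s : rhos (- s) = - rhos s.
Proof. by apply: functional_extensionality_dep => x; exact: linearN. Qed.
Lemma rhosB s t : rhos (s - t) = rhos s - rhos t.
Proof. by rewrite rhosD rhosN. Qed.
Lemma rhosF h s : rhos (fscale h s) = fscale h (rhos s).
Proof. by apply: functional_extensionality_dep => x; exact: linearZ. Qed.

Lemma gfun_pd f e x : gfun (dd f) e x = 2^-1 * vapp (rhos e) f x.
Proof.
rewrite /gfun sharpP // => c u v.
by rewrite linearP tangentDE tangentZE; ring.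
Qed.

Lemma gfunC s t x : gfun s t x = gfun t s x.
Proof. exact: metric_sym. Qed.

Lemma gfunDl s t e x : gfun (s + t) e x = gfun s e x + gfun t e x.
Proof. exact: metricDl. Qed.
Lemma gfunDr s t e x : gfun e (s + t) x = gfun e s x + gfun e t x.
Proof. exact: metricDr. Qed.
Lemma gfunNl s e x : gfun (- s) e x = - gfun s e x.
Proof. exact: metricNl. Qed.
Lemma gfunNr s e x : gfun e (- s) x = - gfun e s x.
Proof. exact: metricNr. Qed.
Lemma gfunFl h s e x : gfun (fscale h s) e x = h x * gfun s e x.
Proof. exact: metricZl. Qed.
Lemma gfunFr h s e x : gfun e (fscale h s) x = h x * gfun e s x.
Proof. exact: metricZr. Qed.
Lemma gfunZl a s e x : gfun (a *: s) e x = a * gfun s e x.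
Proof. exact: metricZl. Qed.
Lemma gfun0l e x : gfun 0 e x = 0.
Proof. exact: metric0l. Qed.
Lemma gfun0r e x : gfun e 0 x = 0.
Proof. exact: metric0r. Qed.

Lemma smooth_pd f : smooth f -> smooth_sect (dd f).
Proof.
move=> sf; apply: smooth_sect_metric => e se.
have -> : gfun e (dd f) = fun x => 2^-1 * vapp (rhos e) f x.
  by apply/funext => x; rewrite gfunC gfun_pd.
by apply: smoothM; [exact: smooth_cst|exact: smooth_rhos].
Qed.

Lemma pdD f h : smooth f -> smooth h -> dd (fun x => f x + h x) = dd f + dd h.
Proof.
move=> sf sh; apply: sect_inj => e x se; rewrite gfunDl !gfun_pd vappD //; ring.
Qed.

Lemma pdZ a f : smooth f -> dd (fun x => a * f x) = a *: dd f.
Proof.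
move=> sf; apply: sect_inj => e x se; rewrite gfunZl !gfun_pd vappZ //; ring.
Qed.

Definition differential_at f x : tangent x -> R^o := fun v => v f.
Fact differential_at_linear f x : linear (@differential_at f x).
Proof. by []. Qed.
HB.instance Definition _ f x :=
  GRing.isLinear.Build R (tangent x) R^o *:%R (@differential_at f x)
    (@differential_at_linear f x).

Lemma imD_pd f x : imD rho x (dd f x).
Proof. by exists (@differential_at f x). Qed.

Lemma imD_kerA_perp x u v : imD rho x u -> rho x v = 0 -> metric u v = 0.
Proof.
move=> [a _ <-] v0; rewrite sharpP ?v0 ?linear0 ?mulr0 // => c p q.
by rewrite !linearP /GRing.scale /=; ring.
Qed.

(** By isotropy of im pd, [(rho u) f = 2 g(pd f, u) = 0] for every smooth [f]. *)
Lemma imD_kerA x u : imD rho x u -> rho x u = 0.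
Proof.
move=> hu; apply: tangent_ext => f sf; have := imD_isotropic (imD_pd f x) hu.
have := sharpP (x := x) (a := fun u => 2^-1 * (rho x u) f) _ u => h.
have -> : metric (dd f x) u = 2^-1 * (rho x u) f.
  by apply: h => c p q; rewrite linearP tangentDE tangentZE; ring.
by rewrite tangent0E; lra.
Qed.

Lemma imD0 x : imD rho x 0.
Proof.
have -> : (0 : E x) = dd (fun=> 0) x; last exact: imD_pd.
apply: metric_inj => w; rewrite metric0l sharpP => [|c p q].
  by rewrite tangent_zero mulr0.
by rewrite !tangent_zero !mulr0 addr0.
Qed.

Lemma imD_lin x a u v : imD rho x u -> imD rho x v -> imD rho x (a *: u + v).
Proof.
have lin2 (b : {linear tangent x -> R^o}) c p q : 2^-1 * b (rho x (c *: p + q)) =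
    c * (2^-1 * b (rho x p)) + 2^-1 * b (rho x q).
  by rewrite !linearP /GRing.scale /=; ring.
move=> [b _ <-] [d _ <-]; exists (a \*: b \+ d) => //.
apply: metric_inj => w; rewrite metricDl metricZl !sharpP //=; last first.
  by move=> c p q; rewrite !linearP /= /GRing.scale /=; ring.
by rewrite /= /GRing.scale /=; ring.
Qed.

End CourantBundle.

(** * Projections attached to a splitting *)

Section Splitting.
Context {R : realType} {M : manifold R} {E : transitive_cbundle M} (S : splitting E).
Local Notation rho := (anchor E).
Local Notation dd := (pd rho).
Local Notation rhos := (anchor_sect rho).
Local Notation Q := (spQ S).
Local Notation C := (spC S).
Implicit Types (s t e : sect E) (f h : M -> R) (x : M) (X : vfield M).

Lemma Qframes : has_frames Q. Proof. exact/subbundle_frames/spQ_sub. Qed.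
Lemma Cframes : has_frames C. Proof. exact/subbundle_frames/spC_sub. Qed.

Lemma C_kerA x u : C x u -> rho x u = 0.
Proof.
move=> Cu; have [kE _] := spC_compl E S x.
have : [set a + b | a in imD rho x & b in C x] u.
  by exists 0; [exact: imD0|exists u => //; rewrite add0r].
by rewrite -kE.
Qed.

Lemma QkerA x u : Q x u -> rho x u = 0 -> u = 0.
Proof.
move=> Qu ku; have [_ /seteqP[+ _]] := spQ_compl E S x.
by move=> /(_ u); apply.
Qed.

Lemma metric_QQ x u v : Q x u -> Q x v -> metric u v = 0.
Proof. exact: spQ_iso. Qed.

Lemma metric_imDC x u c : imD rho x u -> C x c -> metric u c = 0.
Proof. by move=> Iu Cc; apply: imD_kerA_perp => //; exact: C_kerA. Qed.

Lemma metric_QC x q c : Q x q -> C x c -> metric q c = 0.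
Proof.
move=> Qq Cc; apply: (@spPC_orth _ _ _ S) => //.
by exists 0; [exact: imD0|exists q => //; rewrite add0r].
Qed.

Lemma decomposes_exists x (e : E x) : exists u q c, decomposes S e u q c.
Proof.
have [eT _] := spPC E S x; have : [set: E x] e by [].
rewrite eT => -[_ [u Iu [q Qq <-]] [c Cc <-]].
by exists u, q, c.
Qed.

Lemma imD_sub x u v : imD rho x u -> imD rho x v -> imD rho x (u - v).
Proof. by move=> hu hv; rewrite addrC -scaleN1r; exact: imD_lin. Qed.
Lemma Q_sub x u v : Q x u -> Q x v -> Q x (u - v).
Proof. by move=> hu hv; rewrite addrC -scaleN1r; exact: (frames_lin Qframes). Qed.
Lemma C_sub x u v : C x u -> C x v -> C x (u - v).
Proof. by move=> hu hv; rewrite addrC -scaleN1r; exact: (frames_lin Cframes). Qed.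

(** Applying rho to the difference of two decompositions isolates its component
in Q, and pairing with C isolates its component in C. *)
Lemma decomposes_uniq x (e u q c u' q' c' : E x) :
  decomposes S e u q c -> decomposes S e u' q' c' ->
  [/\ u = u', q = q' & c = c'].
Proof.
move=> [Iu Qq Cc ->] [Iu' Qq' Cc' e_].
have hE : (u - u') + (q - q') + (c - c') = 0.
  by rewrite [X in X + _ = _]addrACA -opprD addrACA -opprD e_ subrr.
have qq : q = q'.
  apply/eqP; rewrite -subr_eq0; apply/eqP; apply: QkerA; first exact: Q_sub.
  have := congr1 (rho x) hE; rewrite linear0.
  rewrite (linearD (rho x) (u - u' + (q - q'))) (linearD (rho x) (u - u')).
  by rewrite (imD_kerA (imD_sub Iu Iu')) (C_kerA (C_sub Cc Cc')) add0r addr0.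
have cc : c = c'.
  apply/eqP; rewrite -subr_eq0; apply/eqP; apply: (@spC_nondeg _ _ _ S x);
    first exact: C_sub.
  move=> v Cv; have := congr1 (fun w => metric w v) hE.
  rewrite /= qq subrr addr0 metricDl metric0l (metric_imDC (imD_sub Iu Iu') Cv).
  by rewrite add0r.
split=> //; apply/eqP; rewrite -subr_eq0; move: hE.
by rewrite qq cc !subrr !addr0 => ->.
Qed.

Lemma prI_dec s x (u q c : E x) : decomposes S (s x) u q c -> prI S s x = u.
Proof.
move=> d; have [q' [c' d']] :=
  @xgetPex _ 0 [set u | exists q c, decomposes S (s x) u q c]
  (ex_intro _ u (ex_intro _ q (ex_intro _ c d))).
by have [] := decomposes_uniq d' d.
Qed.

Lemma prQ_dec s x (u q c : E x) : decomposes S (s x) u q c -> prQ S s x = q.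
Proof.
move=> d; have [u' [c' d']] :=
  @xgetPex _ 0 [set q | exists u c, decomposes S (s x) u q c]
  (ex_intro _ q (ex_intro _ u (ex_intro _ c d))).
by have [] := decomposes_uniq d' d.
Qed.

Lemma prC_dec s x (u q c : E x) : decomposes S (s x) u q c -> prC S s x = c.
Proof.
move=> d; have [u' [q' d']] :=
  @xgetPex _ 0 [set c | exists u q, decomposes S (s x) u q c]
  (ex_intro _ c (ex_intro _ u (ex_intro _ q d))).
by have [] := decomposes_uniq d' d.
Qed.

Lemma pr_decomposes s x : decomposes S (s x) (prI S s x) (prQ S s x) (prC S s x).
Proof.
have [u [q [c d]]] := decomposes_exists (s x).
by rewrite (prI_dec d) (prQ_dec d) (prC_dec d).
Qed.

Lemma prI_in s x : imD rho x (prI S s x). Proof. by have [] := pr_decomposes s x. Qed.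
Lemma prQ_in s x : Q x (prQ S s x). Proof. by have [] := pr_decomposes s x. Qed.
Lemma prC_in s x : C x (prC S s x). Proof. by have [] := pr_decomposes s x. Qed.

Lemma pr_sum s : s = prI S s + prQ S s + prC S s.
Proof.
by apply: functional_extensionality_dep => x; have [_ _ _ ->] := pr_decomposes s x.
Qed.

Lemma pr_lin f s t : [/\ prI S (fscale f s + t) = fscale f (prI S s) + prI S t,
  prQ S (fscale f s + t) = fscale f (prQ S s) + prQ S t &
  prC S (fscale f s + t) = fscale f (prC S s) + prC S t].
Proof.
have d x : decomposes S ((fscale f s + t) x)
   ((fscale f (prI S s) + prI S t) x) ((fscale f (prQ S s) + prQ S t) x)
   ((fscale f (prC S s) + prC S t) x).
  have [Is Qs Cs es] := pr_decomposes s x; have [It Qt Ct et] := pr_decomposes t x.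
  split; [exact: imD_lin|exact: (frames_lin Qframes)|exact: (frames_lin Cframes)|].
  change (f x *: s x + t x = f x *: prI S s x + prI S t x +
    (f x *: prQ S s x + prQ S t x) + (f x *: prC S s x + prC S t x)).
  by rewrite {1}es {1}et !scalerDr addrACA [X in X + _]addrACA.
split; apply: functional_extensionality_dep => x.
- exact: prI_dec (d x).
- exact: prQ_dec (d x).
- exact: prC_dec (d x).
Qed.

Lemma pr_of_imD s : (forall x, imD rho x (s x)) ->
  [/\ prI S s = s, prQ S s = 0 & prC S s = 0].
Proof.
move=> Is; have d x : decomposes S (s x) (s x) 0 0.
  by split=> //; [exact: (frames0 Qframes)|exact: (frames0 Cframes)|rewrite !addr0].
split; apply: functional_extensionality_dep => x;
  [exact: prI_dec (d x)|exact: prQ_dec (d x)|exact: prC_dec (d x)].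
Qed.

Lemma pr_of_Q s : (forall x, Q x (s x)) ->
  [/\ prI S s = 0, prQ S s = s & prC S s = 0].
Proof.
move=> Is; have d x : decomposes S (s x) 0 (s x) 0.
  by split=> //; [exact: imD0|exact: (frames0 Cframes)|rewrite addr0 add0r].
split; apply: functional_extensionality_dep => x;
  [exact: prI_dec (d x)|exact: prQ_dec (d x)|exact: prC_dec (d x)].
Qed.

Lemma pr_of_C s : (forall x, C x (s x)) ->
  [/\ prI S s = 0, prQ S s = 0 & prC S s = s].
Proof.
move=> Is; have d x : decomposes S (s x) 0 0 (s x).
  by split=> //; [exact: imD0|exact: (frames0 Qframes)|rewrite !add0r].
split; apply: functional_extensionality_dep => x;
  [exact: prI_dec (d x)|exact: prQ_dec (d x)|exact: prC_dec (d x)].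
Qed.

Lemma sigmaP X x : Q x (sigma S X x) /\ rho x (sigma S X x) = X x.
Proof.
apply: (@xgetPex _ 0 [set q | Q x q /\ rho x q = X x]).
have [v vX] := anchor_surj E (X x); have [vE _] := spQ_compl E S x.
have : [set: E x] v by [].
rewrite vE => -[k kk [q Qq kq]]; exists q; split=> //.
by rewrite -vX -kq linearD kk add0r.
Qed.

Lemma sigma_eq X x q : Q x q -> rho x q = X x -> sigma S X x = q.
Proof.
move=> Qq rq; have [Qs rs] := sigmaP X x; apply/eqP; rewrite -subr_eq0; apply/eqP.
by apply: QkerA; [exact: Q_sub|rewrite linearB /= rs rq subrr].
Qed.

Lemma rhos_sigma X : rhos (sigma S X) = X.
Proof. by apply: functional_extensionality_dep => x; have [] := sigmaP X x. Qed.

Lemma prQ_sigma s : prQ S s = sigma S (rhos s).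
Proof.
apply: functional_extensionality_dep => x; symmetry; apply: sigma_eq;
  first exact: prQ_in.
have [Iu Qq Cc e] := pr_decomposes s x.
by rewrite /anchor_sect [in RHS]e !linearD (imD_kerA Iu) (C_kerA Cc) add0r addr0.
Qed.

Lemma sigma_lin f X (Y : vfield M) :
  sigma S (fscale f X + Y) = fscale f (sigma S X) + sigma S Y.
Proof.
apply: functional_extensionality_dep => x; have [Q1 r1] := sigmaP X x;
  have [Q2 r2] := sigmaP Y x.
apply: sigma_eq; first exact: (frames_lin Qframes).
by rewrite linearP r1 r2.
Qed.

(** Tested against the functionals [u |-> (rho u) f], which separate the points of
Q because rho is injective there. *)
Lemma smooth_sigma X : smooth_vf X -> smooth_sect (sigma S X).
Proof.
move=> sX; apply: (smooth_sect_test (F := Q) (I := {f : M -> R | smooth f})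
  (l := fun i x u => rho x u (sval i))).
- exact: Qframes.
- by move=> x; have [] := sigmaP X x.
- by move=> i x a u v; rewrite linearP.
- by move=> [f sf] W b oW sb; exact: anchor_smooth.
- move=> [f sf] /=; have -> : (fun x => rho x (sigma S X x) f) = vapp X f;
  last exact: sX.
  by apply/funext => x; have [_ ->] := sigmaP X x.
- move=> x u Qu h; apply: QkerA => //; apply: tangent_ext => f sf.
  exact: (h (exist _ f sf)).
Qed.

Lemma smooth_prQ s : smooth_sect s -> smooth_sect (prQ S s).
Proof. by move=> ss; rewrite prQ_sigma; exact/smooth_sigma/smooth_rhos. Qed.

(** Tested against the pairings with sections of C, where [prC s] and [s] agree. *)
Lemma smooth_prC s : smooth_sect s -> smooth_sect (prC S s).
Proof.
move=> ss; apply: (smooth_sect_test (F := C) (I := {c : sect E | Gamma C c})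
  (l := fun i x u => metric (sval i x) u)).
- exact: Cframes.
- exact: prC_in.
- by move=> i x a u v; rewrite metricDr metricZr.
- by move=> [c [sc Cc]] W b oW sb; apply: metric_smooth => //; exact: smooth_sectW.
- move=> [c [sc Cc]] /=; have -> : (fun x => metric (c x) (prC S s x)) = gfun c s.
    apply/funext => x; have [Iu Qq Cc' e] := pr_decomposes s x.
    rewrite /gfun [in RHS]e !metricDr (metric_sym _ (prI S s x)) (metric_sym _
      (prQ S s x)).
    by rewrite (metric_imDC Iu (Cc x)) (metric_QC Qq (Cc x)) !add0r.
  exact: smooth_gfun.
- move=> x u Cu h; apply: (@spC_nondeg _ _ _ S x) => // v Cv.
  have [c Gc cv] := Gamma_extend Cframes Cv.
  by rewrite metric_sym -cv; exact: (h (exist _ c Gc)).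
Qed.

Lemma smooth_prI s : smooth_sect s -> smooth_sect (prI S s).
Proof.
move=> ss; have -> : prI S s = s - prQ S s - prC S s.
  by apply/eqP; rewrite eq_sym !subr_eq {1}(pr_sum s) addrAC.
by apply: smooth_sectB; [apply: smooth_sectB => //;
  exact: smooth_prQ|exact: smooth_prC].
Qed.

(** Some differentials [df_1, ..., df_k] have an invertible matrix on a frame of Q,
because tangent vectors are separated by functions.  A combination of the [f_i]
thus realizes any prescribed pairings with Q, and pairings with ker rho vanish
on both sides. *)
Lemma kerA_perp_exact x u : (forall v, rho x v = 0 -> metric u v = 0) ->
  exists2 f, smooth f & u = dd f x.
Proof.
move=> hu; have [W [k [q [Wx [oW sq hq hq0]]]]] := Qframes x.
have Qi i : Q x (q i x).
  apply/(hq _ _ Wx); exists (delta_mx i 0).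
  rewrite (bigD1 i) //= mxE !eqxx scale1r big1 ?addr0 // => j ji.
  by rewrite mxE (negbTE ji) scale0r.
pose I := {f : M -> R | smooth f}.
have [iota uA] : exists iota : 'I_k -> I,
    (\matrix_(i < k) \row_j (rho x (q j x) (sval (iota i)))) \in unitmx.
  apply: (separating_rows (P := fun i : I => \row_j (rho x (q j x) (sval i)))) => a ha.
  apply: (hq0 x) => //; apply: QkerA; first by apply/hq => //; exists a.
  apply: tangent_ext => f sf; rewrite linear_sum.
  have /matrixP/(_ 0 0) := ha (exist _ f sf); rewrite !mxE => h.
  rewrite tangent0E -[RHS]h.
  have -> : (\sum_i rho x (a i 0 *: q i x)) f = \sum_i rho x (a i 0 *: q i x) f.
    by elim/big_ind2: _ => // p v r w <- <-.
  by apply: eq_bigr => j _; rewrite mxE linearZ tangentZE mulrC.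
set A := (\matrix_(i < k) _) in uA.
pose t : 'rV[R]_k := (2 *: \row_j metric u (q j x)) *m invmx A.
have tA : t *m A = 2 *: \row_j metric u (q j x) by rewrite mulmxKV.
pose g y := \sum_i t 0 i * sval (iota i) y.
have st i : smooth (fun y => t 0 i * sval (iota i) y).
  by apply: smoothM; [exact: smooth_cst|exact: (svalP (iota i))].
have sg : smooth g by apply: smooth_on_sum => //; exact: openT.
exists g => //; apply: metric_inj => v.
have [vE _] := spQ_compl E S x; have : [set: E x] v by [].
rewrite vE => -[w kw [r Qr <-]]; rewrite !metricDr hu // add0r.
have pdg (v' : E x) : metric (dd g x) v' = 2^-1 * rho x v' g.
  by rewrite sharpP // => c p p'; rewrite linearP tangentDE tangentZE; ring.
rewrite !pdg kw tangent0E mulr0 add0r.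
have [c ->] := (hq x r Wx).1 Qr.
apply: (big_ind (fun r => metric u r = 2^-1 * rho x r g));
  first by rewrite metric0r linear0 tangent0E mulr0.
  by move=> p p' h h'; rewrite metricDr linearD tangentDE h h'; ring.
move=> j _; rewrite metricZr linearZ tangentZE mulrCA; congr (_ * _).
rewrite /g tangent_sum //; have /rowP/(_ j) := tA;
  rewrite mxE [RHS]mxE [X in _ = 2 * X]mxE.
move=> h; have -> : metric u (q j x) = 2^-1 * (2 * metric u (q j x)) by rewrite mulKf.
rewrite -h; congr (_ * _); apply: eq_bigr => i _.
by rewrite tangentZ ?[A i j]mxE ?mxE //; exact: (svalP (iota i)).
Qed.

Lemma imD_exact x u : imD rho x u -> exists2 f, smooth f & u = dd f x.
Proof. by move=> Iu; apply: kerA_perp_exact => v; exact: imD_kerA_perp. Qed.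

Lemma kerA_perp x u : (forall v, rho x v = 0 -> metric u v = 0) -> imD rho x u.
Proof. by move=> /kerA_perp_exact[f _ ->]; exact: imD_pd. Qed.

End Splitting.

(** * The Dorfman product of a pre-Courant algebroid *)

Section Dorfman.
Context {R : realType} {M : manifold R} {E : transitive_cbundle M}.
Local Notation rho := (anchor E).
Local Notation dd := (pd rho).
Local Notation rhos := (anchor_sect rho).
Local Notation sm := smooth_sect.
Variables (br : sect E -> sect E -> sect E) (hbr : pre_courant br).
Implicit Types (a b c d e s t : sect E) (f h : M -> R) (x : M).

Lemma rhos_pd f : rhos (dd f) = 0.
Proof. by apply: functional_extensionality_dep => x; exact: imD_kerA (imD_pd f x). Qed.

Fact dorfman_key : unit. Proof. exact: tt. Qed.
(** Locked because rewriting with the rules for sums would otherwise unfold it. *)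
Definition dorfman : sect E -> sect E -> sect E :=
  locked_with dorfman_key (fun a b => br a b + dd (gfun a b)).

Lemma dorfmanE a b : dorfman a b = br a b + dd (gfun a b).
Proof. by rewrite /dorfman unlock. Qed.

Local Notation "a \od b" := (dorfman a b) (at level 40, left associativity).

Lemma smooth_dorfman a b : sm a -> sm b -> sm (a \od b).
Proof.
move=> sa sb; rewrite dorfmanE; apply: smooth_sectD; first exact: br_smooth.
exact/smooth_pd/smooth_gfun.
Qed.

Lemma dorfmanDl a b c : sm a -> sm b -> sm c -> (a + b) \od c = a \od c + b \od c.
Proof.
move=> sa sb sc; rewrite !dorfmanE; have := br_linear hbr 1 sa sb sc;
  rewrite !scale1r => ->.
have -> : gfun (a + b) c = fun x => gfun a c x + gfun b c x.
  by apply/funext => x; exact: gfunDl.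
rewrite pdD; [exact: addrACA|exact: smooth_gfun|exact: smooth_gfun].
Qed.

Lemma dorfman0l c : sm c -> 0 \od c = 0.
Proof.
move=> sc; have s0 := @smooth_sect0 _ _ E.
by have := dorfmanDl s0 s0 sc; rewrite addr0 => /eqP;
  rewrite -subr_eq0 opprD addNKr oppr_eq0 => /eqP.
Qed.

Lemma dorfmanNl a c : sm a -> sm c -> (- a) \od c = - (a \od c).
Proof.
move=> sa sc; apply/eqP; rewrite -subr_eq0 opprK -dorfmanDl ?addNr ?dorfman0l //.
exact: smooth_sectN.
Qed.

Lemma dorfman_anchor a b : sm a -> sm b -> rhos (a \od b) = lie (rhos a) (rhos b).
Proof. by move=> sa sb; rewrite dorfmanE rhosD rhos_pd addr0 br_anchor. Qed.

Lemma dorfman_metric a b c x : sm a -> sm b -> sm c ->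
  vapp (rhos a) (gfun b c) x = gfun (a \od b) c x + gfun b (a \od c) x.
Proof. by move=> sa sb sc; rewrite !dorfmanE (br_metric hbr). Qed.

Lemma dorfman_sym a b : sm a -> sm b -> a \od b + b \od a = 2 *: dd (gfun a b).
Proof.
move=> sa sb; rewrite !dorfmanE (br_skew hbr sa sb).
have -> : gfun b a = gfun a b by apply/funext => x; exact: gfunC.
by rewrite addrACA addNr add0r scaler_nat mulr2n.
Qed.

(** Invariance of the metric, with [g(pd h, e) = (rho e) h / 2]. *)
Lemma dorfman_pd a h : sm a -> smooth h -> a \od dd h = dd (vapp (rhos a) h).
Proof.
move=> sa sh; apply: sect_inj => e x se; have sd := @smooth_pd _ _ E _ sh.
have := dorfman_metric x sa sd se.
have -> : gfun (dd h) e = fun y => 2^-1 * vapp (rhos e) h y.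
  by apply/funext => y; exact: gfun_pd.
rewrite vappZ; last exact: smooth_rhos.
have sra := smooth_rhos sa; have sre := smooth_rhos se.
rewrite !gfun_pd dorfman_anchor // lieE //; lra.
Qed.

Lemma pd_dorf a h : sm a -> smooth h -> dd h \od a = 0.
Proof.
move=> sa sh; have sd := @smooth_pd _ _ E _ sh; apply/eqP.
rewrite -(inj_eq (addrI (a \od dd h))) addr0 dorfman_sym // dorfman_pd //; apply/eqP.
have -> : gfun a (dd h) = fun y => 2^-1 * vapp (rhos a) h y.
  by apply/funext => y; rewrite gfunC gfun_pd.
rewrite pdZ; last exact: smooth_rhos.
by rewrite scalerA divff ?scale1r // pnatr_eq0.
Qed.

(** A consequence of the invariance of the metric alone: the product is determined
by its pairings. *)
Lemma dorfman_leibniz a f b c : sm a -> sm b -> sm c -> smooth f ->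
  a \od (fscale f b + c) = fscale f (a \od b) + (fscale (vapp (rhos a) f) b + a \od c).
Proof.
move=> sa sb sc sf; apply: sect_inj => e x se.
have sfb := smooth_fscale sf sb; have sfbc := smooth_sectD sfb sc.
have := dorfman_metric x sa sfbc se.
have -> : gfun (fscale f b + c) e = fun y => f y * gfun b e y + gfun c e y.
  by apply/funext => y; rewrite gfunDl gfunFl.
have sbe := smooth_gfun sb se; have sce := smooth_gfun sc se.
rewrite vappD //; last exact: smoothM.
rewrite vappM // !dorfman_metric // !gfunDl !gfunFl; lra.
Qed.

Lemma dorfmanDr a b c : sm a -> sm b -> sm c -> a \od (b + c) = a \od b + a \od c.
Proof.
move=> sa sb sc; have s1 := @smooth_cst _ M 1.
have := dorfman_leibniz sa sb sc s1; rewrite !fscale_cst !scale1r => ->.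
congr (_ + _); rewrite -[RHS]add0r; congr (_ + _); apply: sect_inj => e x se.
by rewrite gfunFl gfun0l /vapp tangent_cst mul0r.
Qed.

Lemma dorfmanZr a k b : sm a -> sm b -> a \od (k *: b) = k *: (a \od b).
Proof.
move=> sa sb; have sk := @smooth_cst _ M k; have s0 := @smooth_sect0 _ _ E.
have := dorfman_leibniz sa sb s0 sk; rewrite !fscale_cst addr0 => ->.
have -> : fscale (vapp (rhos a) (fun=> k)) b = 0.
  by apply: sect_inj => e x se; rewrite gfunFl /vapp tangent_cst mul0r gfun0l.
have := dorfmanDr sa s0 s0; rewrite addr0 => /eqP.
by rewrite -subr_eq0 opprD addNKr oppr_eq0 => /eqP ->; rewrite !addr0.
Qed.

(** The defect of the Leibniz rule for the Dorfman product. *)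
Definition loday a b c : sect E := a \od (b \od c) - (a \od b) \od c - b \od (a \od c).

Lemma lodayE a b c : loday a b c = a \od (b \od c) - (a \od b) \od c - b \od (a \od c).
Proof. by []. Qed.

Lemma loday_lin3 a b f c d : sm a -> sm b -> sm c -> sm d -> smooth f ->
  loday a b (fscale f c + d) = fscale f (loday a b c) + loday a b d.
Proof.
move=> sa sb sc sd sf; have sra := smooth_rhos sa; have srb := smooth_rhos sb.
have sab := smooth_dorfman sa sb; have sbc := smooth_dorfman sb sc; have sac :=
  smooth_dorfman sa sc.
have sbd := smooth_dorfman sb sd; have sad := smooth_dorfman sa sd.
have saf := sra f sf; have sbf := srb f sf.
have s1 := smooth_fscale sbf sc; have s2 := smooth_fscale saf sc.
have s3 := smooth_sectD s1 sbd; have s4 := smooth_sectD s2 sad.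
apply: sect_inj => e x se; rewrite /loday !dorfman_leibniz //.
rewrite !(gfunDl, gfunNl, gfunFl) dorfman_anchor // lieE //; ring.
Qed.

(** The symmetric part of the product is exact, and multiplication on the left by
an exact section is zero. *)
Lemma loday_skew12 a b c : sm a -> sm b -> sm c -> loday a b c = - loday b a c.
Proof.
move=> sa sb sc; have sab := smooth_dorfman sa sb; have sba := smooth_dorfman sb sa.
have h : (a \od b) \od c + (b \od a) \od c = 0.
  rewrite -dorfmanDl // dorfman_sym // -pdZ; last exact: smooth_gfun.
  by rewrite pd_dorf //; apply: smoothM; [exact: smooth_cst|exact: smooth_gfun].
apply: sect_inj => e x se; have := congr1 (fun s => gfun s e x) h.
rewrite /loday /= !(gfunDl, gfunNl, gfun0l); lra.
Qed.

(** Left multiplication by [a] acts on the metric as the derivation [rho a]; the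
commutator of two such actions is compared with the one of [a o b]. *)
Lemma loday_skew34 a b c e x : sm a -> sm b -> sm c -> sm e ->
  gfun (loday a b c) e x = - gfun (loday a b e) c x.
Proof.
move=> sa sb sc se; have sra := smooth_rhos sa; have srb := smooth_rhos sb.
have sab := smooth_dorfman sa sb; have sbc := smooth_dorfman sb sc; have sac :=
  smooth_dorfman sa sc.
have sbe := smooth_dorfman sb se; have sae := smooth_dorfman sa se.
have m s : sm s -> vapp (rhos s) (gfun c e) =
    fun y => gfun (s \od c) e y + gfun c (s \od e) y.
  by move=> ss; apply/funext => y; exact: dorfman_metric.
have := dorfman_metric x sab sc se; rewrite dorfman_anchor // lieE // !m //.
do 2 (rewrite vappD; try exact: smooth_gfun).
rewrite !dorfman_metric // /loday !(gfunDl, gfunNl) ![gfun c _ x]gfunC; lra.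
Qed.

Lemma loday_skew23 a b c : sm a -> sm b -> sm c -> loday a b c = - loday a c b.
Proof.
move=> sa sb sc; have sab := smooth_dorfman sa sb; have sbc := smooth_dorfman sb sc.
have sac := smooth_dorfman sa sc; have scb := smooth_dorfman sc sb.
have sg := smooth_gfun sb sc.
have h1 : a \od (b \od c) + a \od (c \od b) = 2 *: dd (vapp (rhos a) (gfun b c)).
  rewrite -dorfmanDr // dorfman_sym // dorfmanZr //; last exact: smooth_pd.
  by rewrite dorfman_pd.
have h2 := dorfman_sym sab sc; have h3 := dorfman_sym sac sb.
have h4 : dd (vapp (rhos a) (gfun b c)) = dd (gfun (a \od b) c) + dd (gfun (a \od c) b).
  rewrite -pdD; try exact: smooth_gfun.
  by congr (dd _); apply/funext => x; rewrite dorfman_metric // (gfunC b).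
rewrite h4 in h1.
apply: sect_inj => e x se.
have := congr1 (fun s => gfun s e x) h1; have := congr1 (fun s => gfun s e x) h2.
have := congr1 (fun s => gfun s e x) h3.
rewrite /loday /= !(gfunDl, gfunNl, gfunZl); lra.
Qed.

Lemma loday_pd a b h : sm a -> sm b -> smooth h -> loday a b (dd h) = 0.
Proof.
move=> sa sb sh; have sra := smooth_rhos sa; have srb := smooth_rhos sb.
have sah := sra h sh; have sbh := srb h sh.
rewrite /loday !dorfman_pd //; last exact: smooth_dorfman.
apply: sect_inj => e x se; rewrite dorfman_anchor // !(gfunDl, gfunNl) gfun0l !gfun_pd.
have -> : vapp (lie (rhos a) (rhos b)) h =
    fun y => vapp (rhos a) (vapp (rhos b) h) y - vapp (rhos b) (vapp (rhos a) h) y.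
  by apply/funext => y; exact: lieE.
by rewrite vappB //; [ring|exact: sra|exact: srb].
Qed.

(** Each bracket differs from the product by an exact section.  What remains is an
identity between the functions under [pd]: with [p], [q], [r] the pairings
[g([a, b], c)], [g([b, c], a)], [g([c, a], b)], the invariance of the metric
gives [g(a, b o c) - g(b, a o c) = 2/3 (p + q + r)]. *)
Lemma jacobi_loday a b c : sm a -> sm b -> sm c ->
  br (br a b) c + br (br b c) a + br (br c a) b
  - 3^-1 *: dd (fun x => gfun (br a b) c x + gfun (br b c) a x + gfun (br c a) b x)
  = - loday a b c.
Proof.
move=> sa sb sc.
have brE s t : br s t = s \od t - dd (gfun s t) by rewrite dorfmanE addrK.
have sbr := fun s t hs ht => @br_smooth _ _ _ _ hbr s t hs ht.
have sd s t : sm s -> sm t -> sm (dd (gfun s t)) by move=> ss st;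
  exact/smooth_pd/smooth_gfun.
have brbr s t u : sm s -> sm t -> sm u ->
    br (br s t) u = (s \od t) \od u - dd (gfun (br s t) u).
  move=> ss st su; rewrite (brE (br s t)) {1}brE dorfmanDl // ?dorfmanNl
    ?pd_dorf ?oppr0 ?addr0 //.
  - exact: smooth_gfun.
  - exact: sd.
  - exact: smooth_dorfman.
  - by apply: smooth_sectN; exact: sd.
have sg s t : sm s -> sm t -> smooth (gfun s t) by exact: smooth_gfun.
pose p := gfun (br a b) c; pose q := gfun (br b c) a; pose r := gfun (br c a) b.
have sp : smooth p by apply: sg => //; exact: sbr.
have sq : smooth q by apply: sg => //; exact: sbr.
have sr : smooth r by apply: sg => //; exact: sbr.
have dN : dd (fun x => gfun (br a b) c x + gfun (br b c) a x + gfun (br c a) b x)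
    = dd p + dd q + dd r.
  by rewrite !pdD //; exact: smoothD.
have sbc := smooth_dorfman sb sc; have sac := smooth_dorfman sa sc; have sca :=
  smooth_dorfman sc sa.
have sab := smooth_dorfman sa sb.
have e1 := dorfman_sym sa sbc; have e2 := dorfman_sym sb sac.
have e3 : (a \od c) \od b + (c \od a) \od b = 0.
  rewrite -dorfmanDl // dorfman_sym // -pdZ ?pd_dorf //; last exact: sg.
  by apply: smoothM; [exact: smooth_cst|exact: sg].
(* Write r_a for half the derivative of g(b, c) along a, and similarly r_b.  The
   invariance of the metric for the three cyclic orders gives
   3 (r_a - r_b) = 2 p - q - r. *)
have key : dd (gfun a (b \od c)) - dd (gfun b (a \od c)) = (2 / 3) *: (dd p +
  dd q + dd r).
  rewrite -!pdD -?pdZ; do ?[apply: smoothD|exact: sp|exact: sq|exact: sr] => //.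
  apply/eqP; rewrite subr_eq -pdD; [|by apply: smoothM;
    [exact: smooth_cst|do ?apply: smoothD]|exact: sg].
  apply/eqP; congr (dd _); apply/funext => x.
  have r12 := dorfman_metric x sa sb sc.
  have r23 := dorfman_metric x sb sc sa.
  have r31 := dorfman_metric x sc sa sb.
  move: r12 r23 r31; rewrite !dorfmanE /p /q /r.
  rewrite !(gfunDl, gfunDr) !(gfunC _ (dd _)) !gfun_pd.
  have g1 : gfun b a = gfun a b by apply/funext => y; exact: gfunC.
  have g2 : gfun c a = gfun a c by apply/funext => y; exact: gfunC.
  have g3 : gfun c b = gfun b c by apply/funext => y; exact: gfunC.
  rewrite (br_skew hbr sa sc) (br_skew hbr sb sa) (br_skew hbr sc sb) !gfunNr g1 g2 g3.
  rewrite !(gfunC b (br _ _)) !(gfunC c (br _ _)) !(gfunC a (br _ _)).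
  lra.
rewrite dN !brbr //; apply: sect_inj => e x se.
have := congr1 (fun s => gfun s e x) e1; have := congr1 (fun s => gfun s e x) e2.
have := congr1 (fun s => gfun s e x) e3; have := congr1 (fun s => gfun s e x) key.
rewrite /loday /= !(gfunDl, gfunNl, gfunZl, gfun0l) -/p -/q -/r; lra.
Qed.

Lemma courant_loday : courant br <->
  forall a b c, sm a -> sm b -> sm c -> loday a b c = 0.
Proof.
split=> [hc a b c sa sb sc|h].
  have := jacobi_loday sa sb sc;
    rewrite (courant_jacobi hc sa sb sc) subrr => /esym/eqP.
  by rewrite oppr_eq0 => /eqP.
split=> // a b c sa sb sc; apply/eqP; rewrite -subr_eq0 jacobi_loday // h //.
by rewrite oppr0.
Qed.

End Dorfman.

(** * The bracket of a suitable connection *)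

Section Bracket.
Context {R : realType} {M : manifold R} {E : transitive_cbundle M} {S : splitting E}.
Variable (N : suitable_conn S).
Local Notation rho := (anchor E).
Local Notation dd := (pd rho).
Local Notation rhos := (anchor_sect rho).
Local Notation sm := smooth_sect.
Local Notation smv := smooth_vf.
Local Notation Q := (spQ S).
Local Notation C := (spC S).
Local Notation I := (imD rho).
Local Notation D := (nabla N).
Implicit Types (a b c d e s t u q : sect E) (f h : M -> R) (x : M) (X Y : vfield M).

Lemma Gamma_whole s : sm s -> Gamma (whole E) s.
Proof. by []. Qed.

Lemma connection0 F (DF : vfield M -> sect E -> sect E) X : is_connection F DF ->
  Gamma F 0 -> smv X -> DF X 0 = 0.
Proof.
move=> cF G0 sX; have := conn_linr cF 1 sX G0 G0.
by rewrite !scale1r addr0 => /eqP; rewrite -subr_eq0 opprD addNKr oppr_eq0 => /eqP.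
Qed.

Lemma Gamma_imD0 : Gamma I (0 : sect E).
Proof. by split; [exact: smooth_sect0|move=> x; exact: imD0]. Qed.
Lemma Gamma_Q0 : Gamma Q 0.
Proof. by split; [exact: smooth_sect0|exact: frames0 (Qframes S)]. Qed.
Lemma Gamma_C0 : Gamma C 0.
Proof. by split; [exact: smooth_sect0|exact: frames0 (Cframes S)]. Qed.

Lemma Gamma_prI s : sm s -> Gamma I (prI S s).
Proof. by move=> ss; split; [exact: smooth_prI|exact: prI_in]. Qed.
Lemma Gamma_prQ s : sm s -> Gamma Q (prQ S s).
Proof. by move=> ss; split; [exact: smooth_prQ|exact: prQ_in]. Qed.
Lemma Gamma_prC s : sm s -> Gamma C (prC S s).
Proof. by move=> ss; split; [exact: smooth_prC|exact: prC_in]. Qed.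

Lemma nabla_imD X u : smv X -> Gamma I u -> D X u = nabI N X u.
Proof.
move=> sX [su Iu]; have [pI pQ pC] := pr_of_imD S Iu; rewrite /nabla /sum_conn pI pQ pC.
by rewrite (connection0 (nabQ_conn N) Gamma_Q0 sX) (connection0 (nabC_conn N)
  Gamma_C0 sX) !addr0.
Qed.

Lemma nabla_Q X q : smv X -> Gamma Q q -> D X q = nabQ N X q.
Proof.
move=> sX [su Iu]; have [pI pQ pC] := pr_of_Q Iu; rewrite /nabla /sum_conn pI pQ pC.
by rewrite (connection0 (nabI_conn N) Gamma_imD0 sX) (connection0 (nabC_conn N)
  Gamma_C0 sX) addr0 add0r.
Qed.

Lemma nabla_C X c : smv X -> Gamma C c -> D X c = nabC N X c.
Proof.
move=> sX [su Iu]; have [pI pQ pC] := pr_of_C Iu; rewrite /nabla /sum_conn pI pQ pC.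
by rewrite (connection0 (nabI_conn N) Gamma_imD0 sX) (connection0 (nabQ_conn N)
  Gamma_Q0 sX) !add0r.
Qed.

Lemma Gamma_nabla_imD X u : smv X -> Gamma I u -> Gamma I (D X u).
Proof. by move=> sX Gu; rewrite nabla_imD //; exact: (conn_val (nabI_conn N)). Qed.
Lemma Gamma_nabla_Q X q : smv X -> Gamma Q q -> Gamma Q (D X q).
Proof. by move=> sX Gu; rewrite nabla_Q //; exact: (conn_val (nabQ_conn N)). Qed.
Lemma Gamma_nabla_C X c : smv X -> Gamma C c -> Gamma C (D X c).
Proof. by move=> sX Gu; rewrite nabla_C //; exact: (conn_val (nabC_conn N)). Qed.

Lemma smooth_nabla X s : smv X -> sm s -> sm (D X s).
Proof. by move=> sX ss; have [] := conn_val (nab_conn N) sX (Gamma_whole ss). Qed.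

Lemma nabla_linl f X Y s : smooth f -> smv X -> smv Y -> sm s ->
  D (fscale f X + Y) s = fscale f (D X s) + D Y s.
Proof. by move=> sf sX sY ss;
  exact: (conn_linl (nab_conn N) sf sX sY (Gamma_whole ss)). Qed.

Lemma nabla_leibniz f X s t : smooth f -> smv X -> sm s -> sm t ->
  D X (fscale f s + t) = fscale f (D X s) + fscale (vapp X f) s + D X t.
Proof.
move=> sf sX ss st; rewrite -(conn_leibniz (nab_conn N) sf sX (Gamma_whole ss)).
have := conn_linr (nab_conn N) 1 sX (Gamma_whole (smooth_fscale sf ss))
  (Gamma_whole st).
by rewrite !scale1r.
Qed.

Lemma nablaD X s t : smv X -> sm s -> sm t -> D X (s + t) = D X s + D X t.
Proof.
move=> sX ss st; have := conn_linr (nab_conn N) 1 sX (Gamma_whole ss) (Gamma_whole st).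
by rewrite !scale1r.
Qed.

Lemma nabla0l s : sm s -> D 0 s = 0.
Proof.
move=> ss; have s1 := @smooth_cst _ M 1; have s0 := @smooth_vf0 _ M.
have := nabla_linl s1 s0 s0 ss; rewrite !fscale_cst !scale1r.
have -> : fscale (fun=> 1) (0 : vfield M) + 0 = 0.
  by apply: vf_ext => f x sf; rewrite vappDE vappFE vapp0E mulr0 addr0.
by move=> /eqP; rewrite -subr_eq0 opprD addNKr oppr_eq0 => /eqP.
Qed.

Lemma nabla_metric X s t x : smv X -> sm s -> sm t ->
  vapp X (gfun s t) x = gfun (D X s) t x + gfun s (D X t) x.
Proof. by move=> sX ss st;
  rewrite (nab_metric N sX (Gamma_whole ss) (Gamma_whole st)). Qed.

Lemma rhos_imD u : (forall x, I x (u x)) -> rhos u = 0.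
Proof. by move=> Iu; apply: functional_extensionality_dep => x; exact: imD_kerA. Qed.
Lemma rhos_C c : (forall x, C x (c x)) -> rhos c = 0.
Proof. by move=> Cc; apply: functional_extensionality_dep => x;
  exact: C_kerA (Cc x). Qed.

Local Notation sg := (sigma S).

Lemma sigma0 : sg 0 = 0.
Proof.
apply: functional_extensionality_dep => x; apply: sigma_eq.
  exact: frames0 (Qframes S) x.
exact: linear0.
Qed.

Lemma sigmaD X Y : sg (X + Y) = sg X + sg Y.
Proof.
have := sigma_lin S (fun=> 1) X Y; rewrite fscale_cst scale1r.
by have -> : fscale (fun=> 1) X = 1 *: X by []; rewrite scale1r.
Qed.

Lemma sigmaN X : sg (- X) = - sg X.
Proof.
have := sigmaD X (- X); rewrite subrr sigma0 => /esym/eqP.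
by rewrite addrC addr_eq0 => /eqP.
Qed.

(** Over ker rho only the components in im pd and C are left, and the connection
preserves both. *)
Lemma rhos_nabla_ker X s : smv X -> sm s -> rhos s = 0 -> rhos (D X s) = 0.
Proof.
move=> sX ss s0; rewrite /nabla /sum_conn.
have -> : prQ S s = 0.
  by rewrite prQ_sigma s0 sigma0.
rewrite (connection0 (nabQ_conn N) Gamma_Q0 sX) addr0 rhosD rhos_imD ?rhos_C ?addr0 //.
  by have [] := conn_val (nabC_conn N) sX (Gamma_prC ss).
by have [] := conn_val (nabI_conn N) sX (Gamma_prI ss).
Qed.

Local Notation T := (torsion N).

Lemma smooth_torsion a b : sm a -> sm b -> smv (T a b).
Proof.
move=> sa sb; have sra := smooth_rhos sa; have srb := smooth_rhos sb.
apply: smooth_vfD.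
  by apply: smooth_rhos; apply: smooth_sectB; exact: smooth_nabla.
by apply: smooth_vfN; exact: smooth_lie.
Qed.

Lemma torsion_skew a b : sm a -> sm b -> T a b = - T b a.
Proof.
move=> sa sb; rewrite /torsion (lie_skew (smooth_rhos sa) (smooth_rhos sb)).
by rewrite -(opprB (D (rhos b) a)) rhosN -opprD.
Qed.

(** The derivatives of [f] produced by the connection and by the Lie bracket
cancel. *)
Lemma torsion_lin a f b c : sm a -> sm b -> sm c -> smooth f ->
  T a (fscale f b + c) = fscale f (T a b) + T a c.
Proof.
move=> sa sb sc sf; have sra := smooth_rhos sa; have srb := smooth_rhos sb.
have src := smooth_rhos sc.
rewrite /torsion (rhosD (fscale f b)) rhosF lie_leibniz // nabla_leibniz //
  nabla_linl //.
move: (D (rhos a) b) (D (rhos a) c) (D (rhos b) a) (D (rhos c) a) => d1 d2 d3 d4.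
rewrite !(rhosD, rhosN, rhosF); apply: vf_ext => h x sh.
rewrite !(vappDE, vappNE, vappFE); ring.
Qed.

Lemma torsion_ker a b : sm a -> sm b -> rhos b = 0 -> T a b = 0.
Proof.
move=> sa sb b0; have sra := smooth_rhos sa.
by rewrite /torsion b0 nabla0l // subr0 rhos_nabla_ker // lie0r // subr0.
Qed.

Lemma torsion_kerl a b : sm a -> sm b -> rhos a = 0 -> T a b = 0.
Proof. by move=> sa sb a0; rewrite torsion_skew // torsion_ker // oppr0. Qed.

Local Notation B := (B1 N).

Lemma B1_cyc a b c x : B a b c x = B b c a x.
Proof. by rewrite /B1 -addrA addrC. Qed.

Lemma B1_skew a b c x : sm a -> sm b -> sm c -> B a b c x = - B b a c x.
Proof.
move=> sa sb sc; rewrite /B1 (torsion_skew sa sb) (torsion_skew sb sc)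
  (torsion_skew sc sa).
rewrite !sigmaN !gfunNl; ring.
Qed.

(** The torsion is tensorial in its second argument, hence in the first one by
skew-symmetry. *)
Lemma B1_linear a b : sm a -> sm b -> Clinear (B a b).
Proof.
move=> sa sb f e e' sf se se' x.
have sfe := smooth_fscale sf se; have sfee := smooth_sectD sfe se'.
have [pI _ _] := pr_lin S f e e'.
rewrite /B1 pI (torsion_skew sfee sa) !torsion_lin //.
rewrite (torsion_skew se sa) (torsion_skew se' sa) !(sigmaN, sigma_lin).
rewrite !(gfunDl, gfunDr, gfunNl, gfunFl, gfunFr); ring.
Qed.

Lemma smooth_B1 a b c : sm a -> sm b -> sm c -> smooth (B a b c).
Proof.
have g1 s t u : sm s -> sm t -> sm u -> smooth (gfun (sg (T s t)) (prI S u)).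
  move=> ss st su; apply: smooth_gfun; last exact: smooth_prI.
  exact/smooth_sigma/smooth_torsion.
by move=> sa sb sc; do 2?apply: smoothD; exact: g1.
Qed.

Lemma beta1P a b : sm a -> sm b -> sm (beta1 N a b) /\
  forall e x, sm e -> gfun (beta1 N a b) e x = B a b e x.
Proof.
move=> sa sb; have [s1 h] :=
  sharp_sectP (B1_linear sa sb) (fun e se => smooth_B1 sa sb se).
by split=> // e x se; rewrite h.
Qed.

Lemma gammaP a b : sm a -> sm b -> sm (gamma N a b) /\ forall e x, sm e ->
  gfun (gamma N a b) e x = 2^-1 * (gfun a (D (rhos e) b) x - gfun b (D (rhos e) a) x).
Proof.
move=> sa sb.
pose L e x := 2^-1 * (gfun a (D (rhos e) b) x - gfun b (D (rhos e) a) x).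
have hL : Clinear L.
  move=> f e e' sf se se' x; have sre := smooth_rhos se; have sre' := smooth_rhos se'.
  rewrite /L rhosD rhosF !nabla_linl // !(gfunDr, gfunFr); ring.
have sL e : sm e -> smooth (L e).
  move=> se; have sre := smooth_rhos se; apply: smoothM; first exact: smooth_cst.
  by apply: smoothD; [|apply: smoothN]; apply: smooth_gfun => //; exact: smooth_nabla.
have [s1 h] := sharp_sectP hL sL.
by split=> // e x se; rewrite /gamma h.
Qed.

Local Notation br := (bracket1 N).

Lemma smooth_bracket1 a b : sm a -> sm b -> sm (br a b).
Proof.
move=> sa sb; have [sgm _] := gammaP sa sb; have [sb1 _] := beta1P sa sb.
have sra := smooth_rhos sa; have srb := smooth_rhos sb.
by do 3?apply: smooth_sectB => //; exact: smooth_nabla.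
Qed.

Lemma bracket1E a b e x : sm a -> sm b -> sm e ->
  gfun (br a b) e x = gfun (D (rhos a) b) e x - gfun (D (rhos b) a) e x
   - 2^-1 * (gfun a (D (rhos e) b) x - gfun b (D (rhos e) a) x) - B a b e x.
Proof.
move=> sa sb se; have [_ hg] := gammaP sa sb; have [_ hb] := beta1P sa sb.
by rewrite /bracket1 !(gfunDl, gfunNl) hg // hb.
Qed.

(** Pairing with [pd f] is half the derivative of [f] along the anchor, so exact
sections detect the image under the anchor. *)
Lemma anchor_eq_pd x (v w : E x) : (forall f, smooth f ->
  metric (dd f x) v = metric (dd f x) w) ->
  rho x v = rho x w.
Proof.
move=> h; apply: tangent_ext => f sf; have := h f sf.
have pdE (v' : E x) : metric (dd f x) v' = 2^-1 * rho x v' f.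
  by rewrite sharpP // => k p p'; rewrite linearP tangentDE tangentZE; ring.
rewrite !pdE; lra.
Qed.

(** Paired with exact sections, [gamma] vanishes and [beta1] reduces to
[sigma (T a b)]; so rho kills the former and sends the latter to the torsion. *)
Lemma bracket1_anchor a b : sm a -> sm b -> rhos (br a b) = lie (rhos a) (rhos b).
Proof.
move=> sa sb; have [sgm hg] := gammaP sa sb; have [sb1 hb] := beta1P sa sb.
have rg : rhos (gamma N a b) = 0.
  apply: functional_extensionality_dep => x; rewrite [RHS](_ : _ = rho x 0);
    last by rewrite linear0.
  apply: anchor_eq_pd => f sf; have := hg (dd f) x (smooth_pd sf).
  by rewrite rhos_pd !nabla0l // !gfun0r subrr mulr0 metric0r metric_sym.
have rb : rhos (beta1 N a b) = T a b.
  rewrite -[RHS](rhos_sigma S); apply: functional_extensionality_dep => x.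
  apply: anchor_eq_pd => f sf; have spf := @smooth_pd _ _ E _ sf.
  have := hb (dd f) x spf; rewrite /gfun metric_sym => ->.
  have [pI _ _] := pr_of_imD S (fun x => imD_pd f x).
  have rf : rhos (dd f) = 0 by exact: rhos_pd.
  rewrite /B1 pI (torsion_ker sb spf rf) (torsion_kerl spf sa rf) sigma0 !gfun0l !addr0.
  by rewrite /gfun metric_sym.
rewrite /bracket1 !rhosB rg rb subr0 /torsion rhosB opprB addrA addrAC subrr add0r //.
Qed.

(** For the metric axiom, the derivatives of [g(e, a)] and [g(e, b)] are expanded by
metricity of the connection; they cancel the terms of [gamma] and those in which
[e] is differentiated, and the two values of [B1] are opposite. *)
Lemma bracket1_pre : pre_courant br.
Proof.
split.
- exact: smooth_bracket1.
- move=> k a a' b sa sa' sb; apply: sect_inj => e x se.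
  have sk := smooth_cst k; have ska := smooth_sectZ k sa; have skaa :=
    smooth_sectD ska sa'.
  have sra := smooth_rhos sa; have sra' := smooth_rhos sa'; have srb := smooth_rhos sb.
  have sre := smooth_rhos se.
  rewrite (gfunDl (k *: br a b)) gfunZl !bracket1E // !(B1_cyc _ b e) -!fscale_cst.
  rewrite (B1_linear sb se) // rhosD rhosF nabla_linl // !nabla_leibniz //.
  move: (D _ a) (D _ a') (D _ b) (D _ b) (D _ b) (D _ a) (D _ a').
  move=> d1 d2 d3 d4 d5 d6 d7.
  rewrite !(gfunDl, gfunDr, gfunFl, gfunFr) /vapp !tangent_cst; ring.
- move=> a b sa sb; apply: sect_inj => e x se.
  rewrite gfunNl !bracket1E // (B1_skew _ sa sb se); ring.
- exact: bracket1_anchor.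
- move=> e a b se sa sb; apply/funext => x.
  have sre := smooth_rhos se; have sra := smooth_rhos sa; have srb := smooth_rhos sb.
  rewrite /= (gfunDl (br e a)) (gfunDr (br e b)) (gfunC a (dd _)) !gfun_pd
    (gfunC a (br _ _)) !bracket1E //.
  rewrite !nabla_metric //.
  have hB : B e b a x = - B e a b x by rewrite B1_cyc B1_skew // -B1_cyc.
  rewrite hB; rewrite !(gfunC _ (D _ _)); lra.
Qed.

Lemma bracket1_cc c1 c2 : Gamma C c1 -> Gamma C c2 -> br c1 c2 = - gamma N c1 c2.
Proof.
move=> [s1 C1] [s2 C2]; have [_ hg] := gammaP s1 s2; apply: sect_inj => e x se.
have r1 := rhos_C C1; have r2 := rhos_C C2.
have [p1 _ _] := pr_of_C C1; have [p2 _ _] := pr_of_C C2.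
rewrite bracket1E // gfunNl hg // r1 r2 !nabla0l // /B1 (torsion_ker s1 s2 r2).
by rewrite p1 p2 sigma0 !gfun0l !gfun0r; ring.
Qed.

Lemma gfun_QQ a b x : Gamma Q a -> Gamma Q b -> gfun a b x = 0.
Proof. by move=> [_ Qa] [_ Qb]; exact: metric_QQ (Qa x) (Qb x). Qed.
Lemma gfun_QC a b x : Gamma Q a -> Gamma C b -> gfun a b x = 0.
Proof. by move=> [_ Qa] [_ Qb]; exact: metric_QC (Qa x) (Qb x). Qed.
Lemma gfun_CQ a b x : Gamma C a -> Gamma Q b -> gfun a b x = 0.
Proof. by move=> Ca Qb; rewrite gfunC gfun_QC. Qed.
Lemma gfun_imDC a b x : Gamma I a -> Gamma C b -> gfun a b x = 0.
Proof. by move=> [_ Qa] [_ Qb]; exact: metric_imDC (Qa x) (Qb x). Qed.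
Lemma gfun_CimD a b x : Gamma C a -> Gamma I b -> gfun a b x = 0.
Proof. by move=> Ca Ib; rewrite gfunC gfun_imDC. Qed.

Lemma Gamma_pd f : smooth f -> Gamma I (dd f).
Proof. by move=> sf; split; [exact: smooth_pd|move=> x; exact: imD_pd]. Qed.

Lemma bracket1_cq c q f : Gamma C c -> Gamma Q q -> smooth f ->
  br c (q + dd f) = - D (rhos q) c.
Proof.
move=> Gc Gq sf; have Gf := Gamma_pd sf; apply: sect_inj => e x se.
have [[sc Cc] [sq _] [sdf _]] := And3 Gc Gq Gf.
have [pc _ _] := pr_of_C Cc; have rc := rhos_C Cc; have sre := smooth_rhos se.
have sqf := smooth_sectD sq sdf.
rewrite bracket1E // gfunNl rc nabla0l // gfun0l rhosD rhos_pd addr0 nablaD //.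
rewrite gfunDr gfunDl (gfun_CQ _ Gc (Gamma_nabla_Q sre Gq)) (gfun_CimD _ Gc
  (Gamma_nabla_imD sre Gf)).
rewrite (gfun_QC _ Gq (Gamma_nabla_C sre Gc)) (gfun_imDC _ Gf (Gamma_nabla_C sre Gc)).
rewrite /B1 pc (torsion_kerl sc sqf rc) (torsion_ker se sc rc) sigma0 !gfun0l
  gfun0r; ring.
Qed.

(** Q is isotropic and stable under the connection, so the bracket pairs to zero with
Q and C; its pairings with im pd are dictated by the anchor. *)
Lemma bracket1_qq q1 q2 : Gamma Q q1 -> Gamma Q q2 ->
  br q1 q2 = sg (lie (rhos q1) (rhos q2)).
Proof.
move=> G1 G2; have [[s1 Q1] [s2 Q2]] := conj G1 G2.
have sr1 := smooth_rhos s1; have sr2 := smooth_rhos s2.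
have sl := smooth_lie sr1 sr2; have Gs : Gamma Q (sg (lie (rhos q1) (rhos q2))).
  by split; [exact: smooth_sigma|move=> x; have [] :=
    sigmaP S (lie (rhos q1) (rhos q2)) x].
have [p1 _ _] := pr_of_Q Q1; have [p2 _ _] := pr_of_Q Q2.
apply: sect_inj => e x se; rewrite (pr_sum S e) !gfunDr; congr (_ + _ + _).
- have [f sf fx] := imD_exact S (prI_in S e x).
  rewrite /gfun fx !(metric_sym _ (dd f x)).
  rewrite -!/(gfun (dd f) _ x) !gfun_pd bracket1_anchor // rhos_sigma //.
- have Ge := Gamma_prQ se; have [se' Qe] := Ge; have sre := smooth_rhos se'.
  have [pe _ _] := pr_of_Q Qe.
  rewrite (gfun_QQ _ Gs Ge) bracket1E // /B1 p1 p2 pe !gfun0r.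
  rewrite (gfun_QQ _ (Gamma_nabla_Q sr1 G2) Ge) (gfun_QQ _ (Gamma_nabla_Q sr2 G1) Ge).
  rewrite (gfun_QQ _ G1 (Gamma_nabla_Q sre G2)) (gfun_QQ _ G2 (Gamma_nabla_Q
    sre G1)); ring.
- have Ge := Gamma_prC se; have [se' Ce] := Ge; have re := rhos_C Ce.
  have [pe _ _] := pr_of_C Ce.
  rewrite (gfun_QC _ Gs Ge) bracket1E // re !nabla0l // /B1 p1 p2 pe !gfun0r.
  rewrite (gfun_QC _ (Gamma_nabla_Q sr1 G2) Ge) (gfun_QC _ (Gamma_nabla_Q sr2
    G1) Ge); ring.
Qed.

(** Half of [a o pd f] is the exact section that separates the product from the
bracket. *)
Lemma bracket1_pd a f : sm a -> smooth f -> br a (dd f) = 2^-1 *: dd (vapp (rhos a) f).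
Proof.
move=> sa sf; have := dorfman_pd bracket1_pre sa sf; rewrite dorfmanE.
have -> : gfun a (dd f) = fun x => 2^-1 * vapp (rhos a) f x.
  by apply/funext => x; rewrite gfunC gfun_pd.
rewrite pdZ; last exact: smooth_rhos.
move=> h; apply: sect_inj => e x se; have := congr1 (fun s => gfun s e x) h.
rewrite /= gfunDl !gfunZl; lra.
Qed.

Lemma bracket1_pq q1 q2 f1 f2 : Gamma Q q1 -> Gamma Q q2 -> smooth f1 -> smooth f2 ->
  br (q1 + dd f1) (q2 + dd f2) = sg (lie (rhos q1) (rhos q2))
    + 2^-1 *: (dd (vapp (rhos q1) f2) - dd (vapp (rhos q2) f1)).
Proof.
move=> G1 G2 sf1 sf2; have [[s1 _] [s2 _]] := conj G1 G2.
have sd1 := @smooth_pd _ _ E _ sf1; have sd2 := @smooth_pd _ _ E _ sf2.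
have brD a b c : sm a -> sm b -> sm c -> br (a + b) c = br a c + br b c.
  move=> sa sb sc; have := br_linear bracket1_pre 1 sa sb sc; by rewrite !scale1r.
have sqd1 := smooth_sectD s1 sd1; have sqd2 := smooth_sectD s2 sd2.
rewrite brD // (br_skew bracket1_pre s1 sqd2) (br_skew bracket1_pre sd1 sqd2) !brD //.
rewrite !bracket1_pd // (br_skew bracket1_pre s2 s1) (br_skew bracket1_pre sd2 s1).
rewrite !bracket1_pd // bracket1_qq // rhos_pd.
have -> : vapp (0 : vfield M) f1 = fun=> 0 by [].
have pd0 : dd (fun=> 0) = 0.
  by apply: sect_inj => e x se; rewrite gfun_pd gfun0l /vapp tangent_cst mulr0.
rewrite pd0 scaler0 addr0 !opprD !opprK scalerDr scalerN.
by rewrite -addrA.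
Qed.

End Bracket.

(** * The Jacobi identity and curvature *)

Section Jacobi.
Context {R : realType} {M : manifold R} {E : transitive_cbundle M} {S : splitting E}.
Variable (N : suitable_conn S).
Local Notation rho := (anchor E).
Local Notation dd := (pd rho).
Local Notation rhos := (anchor_sect rho).
Local Notation sm := smooth_sect.
Local Notation smv := smooth_vf.
Local Notation Q := (spQ S).
Local Notation C := (spC S).
Local Notation I := (imD rho).
Local Notation D := (nabla N).
Local Notation br := (bracket1 N).
Local Notation sg := (sigma S).
Local Notation pre := (bracket1_pre N).
Local Notation "a \od b" := (dorfman br a b) (at level 40, left associativity).
Local Notation loday := (loday br).
Implicit Types (a b c d e s t u q k : sect E) (f h : M -> R) (x : M) (X Y : vfield M).

Lemma pd0 (g : M -> R) : (forall x, g x = 0) -> dd g = 0.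
Proof.
move=> g0; have -> : g = fun=> 0 by apply/funext.
by apply: sect_inj => e x se; rewrite gfun_pd gfun0l /vapp tangent_cst mulr0.
Qed.

(** When [rho k = 0] the product is C^oo-linear in [u], so at each point [u] may be
replaced by an exact section. *)
Lemma dorfman_ker_imD k u : sm k -> rhos k = 0 -> Gamma I u -> k \od u = 0.
Proof.
move=> sk rk [su Iu]; apply: sect_inj => e x se; rewrite gfun0l.
have [f sf ux] := imD_exact S (Iu x).
have hL : Clinear (fun v => gfun (k \od v) e).
  move=> h v w sh sv sw y; rewrite (dorfman_leibniz pre) // !gfunDl !gfunFl rk vapp0E.
  by rewrite mul0r add0r.
rewrite (tensorial_eq hL su (smooth_pd sf) ux) (dorfman_pd pre) // rk.
by rewrite pd0 ?gfun0l // => y; rewrite vapp0E.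
Qed.

Lemma dorfman_imD_ker k u : sm k -> rhos k = 0 -> Gamma I u -> u \od k = 0.
Proof.
move=> sk rk Gu; have [su Iu] := Gu; have := dorfman_sym pre su sk.
rewrite (dorfman_ker_imD sk rk Gu) addr0 => ->.
rewrite pd0 ?scaler0 // => x; apply: imD_kerA_perp; first exact: Iu.
by have := congr1 (fun X : vfield M => X x) rk.
Qed.

Lemma dorfman_qq q1 q2 : Gamma Q q1 -> Gamma Q q2 ->
  q1 \od q2 = sg (lie (rhos q1) (rhos q2)).
Proof.
move=> G1 G2; rewrite dorfmanE bracket1_qq // pd0 ?addr0 // => x; exact: gfun_QQ G1 G2.
Qed.

Lemma dorfman_cq c q : Gamma C c -> Gamma Q q -> c \od q = - D (rhos q) c.
Proof.
move=> Gc Gq; rewrite dorfmanE [dd _]pd0 ?addr0; last by move=> x; exact: gfun_CQ Gc Gq.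
have := bracket1_cq N Gc Gq (@smooth_cst _ M 0).
by rewrite pd0 // addr0.
Qed.

Lemma dorfman_qc q c : Gamma Q q -> Gamma C c -> q \od c = D (rhos q) c.
Proof.
move=> Gq Gc; have [[sq _] [sc _]] := conj Gq Gc; have := dorfman_sym pre sq sc.
rewrite (dorfman_cq Gc Gq) pd0 ?scaler0; last by move=> x; exact: gfun_QC Gq Gc.
by move/eqP; rewrite subr_eq0 => /eqP.
Qed.

(** The pairing with any section of ker rho vanishes, and im pd is the orthogonal of
ker rho. *)
Lemma dorfman_cc c1 c2 : Gamma C c1 -> Gamma C c2 -> Gamma I (c1 \od c2).
Proof.
move=> G1 G2; have [[s1 C1] [s2 C2]] := conj G1 G2.
have s12 := smooth_dorfman pre s1 s2; split=> // x.
apply: (kerA_perp S) => v kv.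
have [e0 se0 e0v] := sect_extend v.
pose e := prI S e0 + prC S e0.
have se : sm e by apply: smooth_sectD; [exact: smooth_prI|exact: smooth_prC].
have re : rhos e = 0.
  by rewrite rhosD (rhos_imD (prI_in S e0)) (rhos_C (prC_in S e0)) addr0.
have ev : e x = v.
  have [Iu Qq Cc ee] := pr_decomposes S e0 x.
  have q0 : prQ S e0 x = 0.
    by rewrite prQ_sigma; apply: sigma_eq;
      [exact: frames0 (Qframes S) x|rewrite linear0 /anchor_sect e0v kv].
  by rewrite -e0v [RHS]ee q0 addr0.
have r1 := rhos_C C1; have r2 := rhos_C C2.
have [p1 _ _] := pr_of_C C1; have [p2 _ _] := pr_of_C C2.
rewrite -ev -/(gfun _ e x) dorfmanE (gfunDl (br c1 c2)) bracket1E // gfun_pd re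
  r1 r2 !nabla0l //.
rewrite /B1 (torsion_ker N s1 s2 r2) p1 p2 sigma0 !gfun0l !gfun0r vapp0E; ring.
Qed.

Lemma Gamma_sigma X : smv X -> Gamma Q (sg X).
Proof. by move=> sX; split; [exact: smooth_sigma|move=> x; have [] :=
  sigmaP S X x]. Qed.

Lemma loday_ccc a b c : Gamma C a -> Gamma C b -> Gamma C c -> loday a b c = 0.
Proof.
move=> Ga Gb Gc; have [[sa Ca] [sb Cb] [sc Cc]] := And3 Ga Gb Gc.
have [Gab Gbc Gac] := And3 (dorfman_cc Ga Gb) (dorfman_cc Gb Gc) (dorfman_cc Ga Gc).
rewrite lodayE (dorfman_ker_imD sa (rhos_C Ca) Gbc) (dorfman_imD_ker sc (rhos_C
  Cc) Gab).
by rewrite (dorfman_ker_imD sb (rhos_C Cb) Gac) !subr0.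
Qed.

Lemma loday_qqq a b c : Gamma Q a -> Gamma Q b -> Gamma Q c -> loday a b c = 0.
Proof.
move=> Ga Gb Gc; have [[sa Ca] [sb Cb] [sc Cc]] := And3 Ga Gb Gc.
have [sra srb src] := And3 (smooth_rhos sa) (smooth_rhos sb) (smooth_rhos sc).
have G X Y : smv X -> smv Y -> Gamma Q (sg (lie X Y)).
  by move=> sX sY; apply: Gamma_sigma; exact: smooth_lie.
rewrite lodayE !dorfman_qq //; do ?exact: G.
rewrite !rhos_sigma (lie_jacobi sra srb src) sigmaD; set p := sg _; set r := sg _.
by rewrite addrAC addrK subrr.
Qed.

(** The curvature of the connection on C. *)
Lemma loday_qqc a b c : Gamma Q a -> Gamma Q b -> Gamma C c -> loday a b c =
  D (rhos a) (D (rhos b) c) - D (rhos b) (D (rhos a) c) - D (lie (rhos a) (rhos b)) c.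
Proof.
move=> Ga Gb Gc; have [[sa Ca] [sb Cb] [sc Cc]] := And3 Ga Gb Gc.
have [sra srb src] := And3 (smooth_rhos sa) (smooth_rhos sb) (smooth_rhos sc).
have Gab : Gamma Q (sg (lie (rhos a) (rhos b))) by apply: Gamma_sigma;
  exact: smooth_lie.
rewrite lodayE (dorfman_qq Ga Gb) !dorfman_qc //; do ?[exact: Gamma_nabla_C].
by rewrite rhos_sigma addrAC.
Qed.

(** By tensoriality [u] may be replaced at each point by an exact section. *)
Lemma loday_imD a b u : sm a -> sm b -> Gamma I u -> loday a b u = 0.
Proof.
move=> sa sb [su Iu]; apply: sect_inj => e x se; rewrite gfun0l.
have [f sf ux] := imD_exact S (Iu x).
have hL : Clinear (fun v => gfun (loday a b v) e).
  by move=> h v w sh sv sw y; rewrite (loday_lin3 pre) // gfunDl gfunFl.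
by rewrite (tensorial_eq hL su (smooth_pd sf) ux) (loday_pd pre) // gfun0l.
Qed.

Lemma loday_add a b c d : sm a -> sm b -> sm c -> sm d ->
  loday a b (c + d) = loday a b c + loday a b d.
Proof.
move=> sa sb sc sd; have := loday_lin3 pre sa sb sc sd (@smooth_cst _ M 1).
by rewrite !fscale_cst !scale1r.
Qed.

Lemma loday_eq0 a b c : sm a -> sm b -> sm c ->
  loday a b (prQ S c) = 0 -> loday a b (prC S c) = 0 -> loday a b c = 0.
Proof.
move=> sa sb sc hQ hC; have [sI sQ sC] :=
  And3 (smooth_prI S sc) (smooth_prQ S sc) (smooth_prC S sc).
rewrite (pr_sum S c) !loday_add //; last exact: smooth_sectD.
by rewrite hQ hC (loday_imD sa sb (Gamma_prI sc)) !addr0.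
Qed.

(** Only the entries in Q and C matter.  Three entries in Q or in C give zero, two
in Q and one in C give the curvature.  One entry in Q and two in C reduce to the
previous cases by pairing with a fourth section and permuting the arguments. *)
Lemma flat_loday : flat C (nabC N) -> forall a b c, sm a -> sm b -> sm c ->
  loday a b c = 0.
Proof.
move=> hflat.
have smQ s : Gamma Q s -> sm s by case.
have smC s : Gamma C s -> sm s by case.
have QQC a b c : Gamma Q a -> Gamma Q b -> Gamma C c -> loday a b c = 0.
  move=> Ga Gb Gc; have [sra srb] :=
    conj (smooth_rhos (smQ a Ga)) (smooth_rhos (smQ b Gb)).
  rewrite loday_qqc // (nabla_C N (smooth_lie sra srb) Gc) (nabla_C N srb Gc)
    (nabla_C N sra Gc) !nabla_C //;
    do ?[exact: (conn_val (nabC_conn N))].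
  exact: hflat.
have z23 a b c : sm a -> sm b -> sm c -> loday a c b = 0 -> loday a b c = 0.
  by move=> sa sb sc h; rewrite (loday_skew23 pre) // h oppr0.
have z12 a b c : sm a -> sm b -> sm c -> loday b a c = 0 -> loday a b c = 0.
  by move=> sa sb sc h; rewrite (loday_skew12 pre) // h oppr0.
have QCQ a b c : Gamma Q a -> Gamma C b -> Gamma Q c -> loday a b c = 0.
  by move=> Ga Gb Gc; apply: (z23); do ?[exact: smQ|exact: smC|exact: QQC].
have QCC a b c : Gamma Q a -> Gamma C b -> Gamma C c -> loday a b c = 0.
  move=> Ga Gb Gc; have [sa sb sc] := And3 (smQ a Ga) (smC b Gb) (smC c Gc).
  apply: sect_inj => e x se; rewrite gfun0l.
  have [GI GQ GC] := And3 (Gamma_prI (S := S) se) (Gamma_prQ (S :=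
    S) se) (Gamma_prC (S := S) se).
  have [sI sQ sC] := And3 GI.1 GQ.1 GC.1.
  (* For the component of e in C, the four arguments are permuted so that a comes
     last and the first three lie in C. *)
  rewrite (pr_sum S e) !gfunDr (loday_skew34 pre x sa sb sc sI) (loday_imD sa sb GI).
  rewrite (loday_skew34 pre x sa sb sc sQ) (QCQ a b _ Ga Gb GQ).
  rewrite (loday_skew12 pre sa sb sc) (loday_skew23 pre sb sa sc) opprK.
  rewrite (loday_skew34 pre x sb sc sa sC) (loday_ccc Gb Gc GC).
  by rewrite !gfun0l oppr0 !addr0.
have CQC a b c : Gamma C a -> Gamma Q b -> Gamma C c -> loday a b c = 0.
  by move=> Ga Gb Gc; apply: (z12); do ?[exact: smQ|exact: smC|exact: QCC].
have CCQ a b c : Gamma C a -> Gamma C b -> Gamma Q c -> loday a b c = 0.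
  by move=> Ga Gb Gc; apply: (z23); do ?[exact: smQ|exact: smC|exact: CQC].
have step3 a b : sm a -> sm b ->
    (forall q, Gamma Q q -> loday a b q = 0) -> (forall c, Gamma C c ->
      loday a b c = 0) ->
    forall c, sm c -> loday a b c = 0.
  move=> sa sb hQ hC c sc.
  by apply: loday_eq0 => //; [apply: hQ; exact: Gamma_prQ|apply: hC; exact: Gamma_prC].
have QQ a b c : Gamma Q a -> Gamma Q b -> sm c -> loday a b c = 0.
  move=> Ga Gb sc; apply: (step3) => // [||q Gq|c' Gc']; do ?[exact: smQ].
    exact: loday_qqq.
  exact: QQC.
have QC a b c : Gamma Q a -> Gamma C b -> sm c -> loday a b c = 0.
  move=> Ga Gb sc; apply: (step3) => // [||q Gq|c' Gc']; do ?[exact: smQ|exact: smC].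
    exact: QCQ.
  exact: QCC.
have CC a b c : Gamma C a -> Gamma C b -> sm c -> loday a b c = 0.
  move=> Ga Gb sc; apply: (step3) => // [||q Gq|c' Gc']; do ?[exact: smQ|exact: smC].
    exact: CCQ.
  exact: loday_ccc.
have Qs a b c : Gamma Q a -> sm b -> sm c -> loday a b c = 0.
  move=> Ga sb sc; have sa := smQ a Ga; apply: (z23) => //.
  apply: (step3) => // [q Gq|c' Gc'].
    by apply: (z23) => //; [exact: smQ|exact: QQ].
  by apply: (z23) => //; [exact: smC|exact: QC].
have Cs a b c : Gamma C a -> sm b -> sm c -> loday a b c = 0.
  move=> Ga sb sc; have sa := smC a Ga; apply: (z23) => //.
  apply: (step3) => // [q Gq|c' Gc'].
    have sq := smQ q Gq; apply: (z23) => //; apply: (z12) => //; exact: QC.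
  by apply: (z23) => //; [exact: smC|exact: CC].
move=> a b c sa sb sc.
apply: (z12) => //; apply: (z23) => //; apply: (step3) => // [q Gq|c' Gc'].
  have sq := smQ q Gq; apply: (z23) => //; apply: (z12) => //; exact: Qs.
have sc' := smC c' Gc'; apply: (z23) => //; apply: (z12) => //; exact: Cs.
Qed.

Lemma loday_flat : (forall a b c, sm a -> sm b -> sm c -> loday a b c = 0) ->
  flat C (nabC N).
Proof.
move=> h X Y c sX sY Gc.
have [GX GY] := conj (Gamma_sigma sX) (Gamma_sigma sY).
have := h _ _ _ GX.1 GY.1 Gc.1; rewrite loday_qqc // !rhos_sigma.
have sXY := smooth_lie sX sY.
by rewrite (nabla_C N sXY Gc) (nabla_C N sY Gc) (nabla_C N sX Gc) !nabla_C //;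
  exact: (conn_val (nabC_conn N)).
Qed.

Lemma flat_whole : flat (whole E) D -> flat C (nabC N).
Proof.
move=> h X Y c sX sY Gc; have := h X Y c sX sY (Gamma_whole Gc.1).
have sXY := smooth_lie sX sY.
by rewrite (nabla_C N sXY Gc) (nabla_C N sY Gc) (nabla_C N sX Gc) !nabla_C //;
  exact: (conn_val (nabC_conn N)).
Qed.

End Jacobi.

Unset Implicit Arguments.

Theorem proposition3p2 (R : realType) (M : manifold R)
    (E : transitive_cbundle M) (S : splitting E) (N : suitable_conn S) :
  [/\ pre_courant (bracket1 N),
      forall (q1 q2 : sect E) (f1 f2 : M -> R),
        Gamma (spQ S) q1 -> Gamma (spQ S) q2 -> smooth f1 -> smooth f2 ->
        bracket1 N (q1 + pd (anchor E) f1) (q2 + pd (anchor E) f2) =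
          sigma S (lie (anchor_sect (anchor E) q1) (anchor_sect (anchor E) q2))
          + 2^-1 *: (pd (anchor E) (vapp (anchor_sect (anchor E) q1) f2)
                     - pd (anchor E) (vapp (anchor_sect (anchor E) q2) f1)),
      forall c1 c2 : sect E, Gamma (spC S) c1 -> Gamma (spC S) c2 ->
        bracket1 N c1 c2 = - gamma N c1 c2,
      forall (c q : sect E) (f : M -> R),
        Gamma (spC S) c -> Gamma (spQ S) q -> smooth f ->
        bracket1 N c (q + pd (anchor E) f) =
          - nabla N (anchor_sect (anchor E) q) c &
      (flat (whole E) (nabla N) -> courant (bracket1 N)) /\
      (courant (bracket1 N) <-> flat (spC S) (nabC N))].
Proof.
have flatP : courant (bracket1 N) <-> flat (spC S) (nabC N).
  apply: (iff_trans (courant_loday (bracket1_pre N))).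
  by split; [exact: loday_flat|exact: flat_loday].
split.
- exact: bracket1_pre.
- by move=> q1 q2 f1 f2; exact: bracket1_pq.
- exact: bracket1_cc.
- exact: bracket1_cq.
- by split=> // /flat_whole /flatP.
Qed.
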